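(* Let $\Omega\subset\mathbb{R}^n$ be a bounded domain such that $(\Omega,k_\Omega)$ is Gromov hyperbolic and $\Omega$ is a QH-visibility domain, so that the identity map $id:(\Omega,k_\Omega)\to(\Omega,d_{Euc})$ extends as a continuous surjective map $\Phi:\overline{\Omega}^G\to\overline{\Omega}^{Euc}$. Then $\Phi$ is a homeomorphism if and only if $\Omega$ has no geodesic loops in $\overline{\Omega}^{Euc}$.
   Context: For a domain $\Omega\subsetneq\mathbb{R}^n$, $\partial_{Euc}\Omega$ and $\overline{\Omega}^{Euc}$ are its Euclidean boundary and closure, $d_{Euc}$ is the Euclidean distance and $\delta_\Omega(x)=d_{Euc}(x,\partial_{Euc}\Omega)$. The quasihyperbolic metric is $k_\Omega(x,y)=\inf_\gamma\int_\gamma\frac{|dx|}{\delta_\Omega(x)}$, the infimum over rectifiable curves in $\Omega$ joining $x$ and $y$; $(\Omega,k_\Omega)$ is a complete, proper, geodesic metric space. A quasihyperbolic geodesic (geodesic ray, geodesic line) is a geodesic (ray, line) of $(\Omega,k_\Omega)$. When $(\Omega,k_\Omega)$ is Gromov hyperbolic, $\partial_G\Omega$ denotes its Gromov boundary and $\overline{\Omega}^G=\Omega\cup\partial_G\Omega$ the Gromov compactification with its usual topology. A bounded domain $\Omega$ is a QH-visibility domain if for every pair $p,q\in\partial_{Euc}\Omega$, $p\neq q$, there exist neighborhoods $U$ of $p$ and $V$ of $q$ in $\mathbb{R}^n$ with $\overline U\cap\overline V=\emptyset$ and a compact set $K\subset\Omega$ such that every quasihyperbolic geodesic $\gamma:[0,T]\to\Omega$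 with $\gamma(0)\in U$ and $\gamma(T)\in V$ satisfies $\gamma([0,T])\cap K\neq\emptyset$. For a quasihyperbolic geodesic line $\gamma:(-\infty,\infty)\to\Omega$, let $\Gamma^{\infty}_\gamma$ (resp. $\Gamma^{-\infty}_\gamma$) be the set of $x\in\overline{\Omega}^{Euc}$ for which there is a sequence $t_k\to\infty$ (resp. $t_k\to-\infty$) with $\gamma(t_k)\to x$. The line $\gamma$ is a geodesic loop in $\overline{\Omega}^{Euc}$ if $\Gamma^{\infty}_\gamma=\Gamma^{-\infty}_\gamma$; $\Omega$ has no geodesic loops in $\overline{\Omega}^{Euc}$ if no quasihyperbolic geodesic line in $\Omega$ is such a loop. *)

(* Defs.v *)
From HB Require Import structures.
From mathcomp Require Import all_boot all_order all_algebra.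
From mathcomp Require Import all_classical all_reals all_analysis.

Set Implicit Arguments.
Unset Strict Implicit.
Unset Printing Implicit Defensive.

Import Order.TTheory GRing.Theory Num.Theory.
Import numFieldNormedType.Exports.

Local Open Scope classical_set_scope.
Local Open Scope ring_scope.

(* Metric geometry of a distance function d on a type X. Curves are total
   functions R -> X; only their values on the relevant interval matter. *)

Definition geodesic_on {R : realType} {X : Type} (d : X -> X -> R)
    (I : set R) (c : R -> X) :=
  forall s t, I s -> I t -> d (c s) (c t) = `|s - t|.

Definition geodesic {R : realType} {X : Type} (d : X -> X -> R) (T : R) :=
  geodesic_on d `[0, T].

Definition geodesic_ray {R : realType} {X : Type} (d : X -> X -> R) :=
  geodesic_on d `[0, +oo[.

Definition geodesic_line {R : realType} {X : Type} (d : X -> X -> R) :=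
  geodesic_on d setT.

Definition gromov_product {R : realType} {X : Type} (d : X -> X -> R)
    (o x y : X) : R :=
  (d x o + d y o - d x y) / 2.

Definition gromov_hyperbolic {R : realType} {X : Type} (d : X -> X -> R) :=
  exists2 delta : R, 0 <= delta & forall o x y z,
    Num.min (gromov_product d o x y) (gromov_product d o y z) - delta
      <= gromov_product d o x z.

Definition asymptotic {R : realType} {X : Type} (d : X -> X -> R)
    (c c' : R -> X) :=
  exists M : R, forall t, 0 <= t -> d (c t) (c' t) <= M.

(* A point at infinity is an equivalence class of geodesic rays. *)
Definition gromov_boundary {R : realType} {X : Type} (d : X -> X -> R) :
    set (set (R -> X)) :=
  [set xi | exists2 c, geodesic_ray d c &
     xi = [set c' | geodesic_ray d c' /\ asymptotic d c c']].

(* The base point o is only used to define the topology below. *)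
Variant gromov_compactification {R : realType} {X : Type} (d : X -> X -> R)
    (o : X) : Type :=
  | gromov_pt of X
  | gromov_infty of gromov_boundary d.
Arguments gromov_pt {R X d o} _.
Arguments gromov_infty {R X d o} _.

(* Generalized ray (Bridson-Haefliger III.H.3): either a geodesic segment,
   extended by a constant, with endpoint in X, or a geodesic ray, whose endpoint
   is its class. *)
Definition generalized_ray_to {R : realType} {X : Type} {d : X -> X -> R}
    {o : X} (c : R -> X) (x : gromov_compactification d o) :=
  match x with
  | gromov_pt p =>
      exists T : R, [/\ 0 <= T, geodesic d T c & forall t, T <= t -> c t = p]
  | gromov_infty xi => geodesic_ray d c /\ \val xi c
  end.

Definition cvg_on_compacts {R : realType} {X : Type} (d : X -> X -> R)
    (c : nat -> R -> X) (c' : R -> X) :=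
  forall M e : R, 0 < e ->
    \forall k \near \oo, forall t, 0 <= t <= M -> d (c k t) (c' t) < e.

(* Bridson-Haefliger, Definition III.H.3.5: u converges to x if there are
   generalized rays from o to the points u k, every subsequence of which has a
   subsequence converging uniformly on compact sets to a generalized ray ending
   at x. *)
Definition gromov_cvg {R : realType} {X : Type} {d : X -> X -> R} {o : X}
    (u : nat -> gromov_compactification d o)
    (x : gromov_compactification d o) :=
  exists2 c : nat -> R -> X,
    forall k, c k 0 = o /\ generalized_ray_to (c k) (u k) &
    forall phi : nat -> nat, {homo phi : i j / (i < j)%N} ->
    exists2 psi : nat -> nat, {homo psi : i j / (i < j)%N} &
    exists c' : R -> X, [/\ c' 0 = o, generalized_ray_to c' x &
      cvg_on_compacts d (c \o phi \o psi) c'].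

Definition gromov_closed {R : realType} {X : Type} {d : X -> X -> R} {o : X}
    (C : set (gromov_compactification d o)) :=
  forall u x, (forall k, C (u k)) -> gromov_cvg u x -> C x.

Section GromovTopology.
Context {R : realType} {X : Type} {d : X -> X -> R} {o : X}.
Local Notation G := (gromov_compactification d o).

Definition gromov_open (A : set G) := gromov_closed (~` A).

Lemma gromov_cvg_subseq (u : nat -> G) x (f : nat -> nat) :
  {homo f : i j / (i < j)%N} -> gromov_cvg u x -> gromov_cvg (u \o f) x.
Proof.
move=> fi [c cu cx]; exists (c \o f); first by move=> k; exact: (cu (f k)).
move=> phi phii; apply: (cx (f \o phi)) => i j ij.
by apply: fi; exact: phii.
Qed.

Lemma frequently_subseq (P : nat -> Prop) :
  (forall N, exists2 k, (N <= k)%N & P k) ->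
  exists2 f : nat -> nat, {homo f : i j / (i < j)%N} & forall k, P (f k).
Proof.
move=> h; have /choice[g gP] : forall N, exists k, (N <= k)%N /\ P k.
  by move=> N; have [k ? ?] := h N; exists k.
exists (fun k => iter k (fun m => g m.+1) (g 0%N)).
  apply: homo_ltn; first exact: ltn_trans.
  by move=> i /=; exact: (gP _).1.
by case=> [|k] /=; exact: (gP _).2.
Qed.

Lemma gromov_openT : gromov_open setT.
Proof. by move=> u x /(_ 0%N) uT _; exfalso; exact: uT. Qed.

Lemma gromov_openI : setI_closed gromov_open.
Proof.
move=> A B oA oB u x uAB ux.
have [h|] := pselect (forall N, exists2 k, (N <= k)%N & (~` A) (u k)).
  have [f fi fA] := frequently_subseq h => -[Ax _].
  exact: (oA _ _ fA (gromov_cvg_subseq fi ux)).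
move=> /existsNP[N hN] [_ Bx].
have fi : {homo addn N : i j / (i < j)%N} by move=> i j; rewrite ltn_add2l.
apply: (oB _ _ _ (gromov_cvg_subseq fi ux)) => // k /= Bk.
apply: (uAB (N + k)%N); split=> //; apply: contrapT => Ak.
by apply: hN; exists (N + k)%N => //; exact: leq_addr.
Qed.

Lemma gromov_open_bigU (I : Type) (f : I -> set G) :
  (forall i, gromov_open (f i)) -> gromov_open (\bigcup_i f i).
Proof.
move=> fo u x uf ux [i _ fix_]; apply: (fo i u x _ ux fix_) => k fk.
by apply: (uf k); exists i.
Qed.

HB.instance Definition _ := gen_eqMixin G.
HB.instance Definition _ := gen_choiceMixin G.
HB.instance Definition _ := isOpenTopological.Build G
  gromov_openT gromov_openI gromov_open_bigU.

End GromovTopology.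

Definition homeomorphism {S T : topologicalType} (f : S -> T) :=
  continuous f /\ exists g : T -> S, [/\ continuous g, cancel f g & cancel g f].

(* Quasihyperbolic geometry. The library's norm on 'rV[R]_n is the sup norm, so
   the Euclidean distance is defined here; both give the same topology and the
   same bounded sets. *)

Definition euc_dist {R : realType} {n : nat} (x y : 'rV[R]_n) : R :=
  Num.sqrt (\sum_i (x ord0 i - y ord0 i) ^+ 2).

Definition euc_boundary {R : realType} {n : nat} (A : set 'rV[R]_n) :
    set 'rV[R]_n :=
  closure A `\` interior A.

Definition domain {R : realType} {n : nat} (Omega : set 'rV[R]_n) :=
  [/\ open Omega, connected Omega & Omega !=set0].

Definition boundary_dist {R : realType} {n : nat} (Omega : set 'rV[R]_n)
    (x : 'rV[R]_n) : R :=
  inf [set euc_dist x y | y in euc_boundary Omega].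

Definition curve_length {R : realType} {n : nat} (g : R -> 'rV[R]_n)
    (a b : R) : \bar R :=
  ereal_sup [set (\sum_(0 <= i < size s)
                    euc_dist (g (nth b (a :: s) i))
                             (g (nth b (a :: s) i.+1)))%:E
            | s in itv_partition a b].

(* Well defined for a rectifiable curve: g is constant on the set of parameters
   t at which its length over [a, t] is s. *)
Definition arclength_param {R : realType} {n : nat} (g : R -> 'rV[R]_n)
    (a b s : R) : 'rV[R]_n :=
  g (xget a [set t | a <= t <= b /\ curve_length g a t = s%:E]).

Definition line_integral {R : realType} {n : nat} (rho : 'rV[R]_n -> R)
    (g : R -> 'rV[R]_n) (a b : R) : R :=
  \int[lebesgue_measure]_(s in `[0, fine (curve_length g a b)])
    rho (arclength_param g a b s).

Definition rectifiable_curve {R : realType} {n : nat} (Omega : set 'rV[R]_n)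
    (x y : 'rV[R]_n) (g : R -> 'rV[R]_n) (a b : R) :=
  [/\ a <= b, {within `[a, b], continuous g},
      forall t, a <= t <= b -> Omega (g t),
      g a = x /\ g b = y & (curve_length g a b < +oo)%E].

Definition qh_metric {R : realType} {n : nat} (Omega : set 'rV[R]_n)
    (x y : Omega) : R :=
  inf [set l | exists g a b,
    rectifiable_curve Omega (\val x) (\val y) g a b /\
    l = line_integral (fun z => (boundary_dist Omega z)^-1) g a b].
Arguments qh_metric {R n} Omega x y.

Definition qh_visible {R : realType} {n : nat} (Omega : set 'rV[R]_n) :=
  forall p q, euc_boundary Omega p -> euc_boundary Omega q -> p <> q ->
  exists U V : set 'rV[R]_n,
    [/\ nbhs p U, nbhs q V, closure U `&` closure V = set0 &
     exists K : set 'rV[R]_n, [/\ compact K, K `<=` Omega &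
       forall (T : R) (g : R -> Omega), 0 <= T ->
         geodesic (qh_metric Omega) T g ->
         U (\val (g 0)) -> V (\val (g T)) ->
         exists2 t, 0 <= t <= T & K (\val (g t))]].

Definition limit_set {R : realType} {n : nat} (Omega : set 'rV[R]_n)
    (F : set_system R) (g : R -> Omega) : set 'rV[R]_n :=
  [set x | closure Omega x /\ exists2 t : nat -> R,
     t @ \oo --> F & (fun k => \val (g (t k))) @ \oo --> x].

Definition geodesic_loop {R : realType} {n : nat} (Omega : set 'rV[R]_n)
    (g : R -> Omega) :=
  geodesic_line (qh_metric Omega) g /\
  limit_set (pinfty_nbhs R) g = limit_set (ninfty_nbhs R) g.

Definition no_geodesic_loops {R : realType} {n : nat}
    (Omega : set 'rV[R]_n) :=
  forall g : R -> Omega, ~ geodesic_loop g.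

(* Main.v *)
(* A curve parametrized by arclength can be cut into pieces that are short
   compared with the distance to the boundary, and a chain of such pieces bounds
   the quasihyperbolic distance from above; hence k is the infimum of the weights
   of chains. Chains give that k is a metric with approximate geodesics and that
   its bounded sets stay away from the boundary, so limits along an ultrafilter
   turn approximate geodesics into geodesics, and sequences of rays into rays.
   In a hyperbolic proper geodesic space this yields that rays converge to their
   ends, that distinct ends are joined by a geodesic line, and that the
   compactification is sequentially compact. If two ends are identified by Phi,
   a line joining them is therefore a loop; conversely the two ends of a loop
   have the same image. An injective Phi is a homeomorphism by compactness. *)

Require Import Defs.
From HB Require Import structures.
From mathcomp Require Import all_boot all_order all_algebra.
From mathcomp Require Import all_classical all_reals all_analysis.
From mathcomp Require Import ring lra.
Import Order.TTheory GRing.Theory Num.Theory.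
Import numFieldNormedType.Exports.
Local Open Scope classical_set_scope.
Local Open Scope ring_scope.

Set Implicit Arguments.
Unset Strict Implicit.
Unset Printing Implicit Defensive.

(** * Ultralimits and geodesics in metric spaces *)

(** The distance is an infimum of integrals along an arclength parametrization picked by [xget], so
    cutting, reversing or joining curves would each call for additivity of length and of the
    integral. Chains avoid this: they are reversed and concatenated by induction, and curves are met
    only when a curve is cut into a chain and when a chain is filled in by segments. An ultrafilter
    [W] finer than [\oo] stands in for the Arzela-Ascoli theorem: along [W] a bounded sequence has a
    limit at every parameter at once, with no diagonal extraction, and subsequences are extracted
    only where [gromov_cvg] asks for them. Hyperbolicity is used through the four-point inequality
    alone, without thin triangles. As the topology of the compactification is given by sequences,
    compactness is sequential too, and the inverse of [Phi] is proved continuous by sequences. *)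

Lemma leq_increasing (f : nat -> nat) : {homo f : i j / (i < j)%N} ->
  forall j, (j <= f j)%N.
Proof. by move=> fi; elim=> // j /leq_ltn_trans; apply; exact: fi. Qed.

Lemma near_le_natr {R : realType} (M : R) : \forall k \near \oo, M <= k%:R.
Proof.
exists (Num.truncn `|M|).+1 => // k /= Mk.
have /andP[_] := truncn_itv (normr_ge0 M).
have := ler_norm M; have : (Num.truncn `|M|).+1%:R <= k%:R :> R by rewrite ler_nat.
lra.
Qed.

Section Ultralimits.
Context {R : realType} {X : Type} (d : X -> X -> R) (W : set_system nat).
Context (dxx : forall x, d x x = 0) (dC : forall x y, d x y = d y x)
  (dtri : forall x y z, d x z <= d x y + d y z)
  (dsep : forall x y, d x y = 0 -> x = y).
Context (Wultra : UltraFilter W) (Wfree : \oo `<=` W).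

Definition ultralimit (u : nat -> X) (p : X) :=
  forall e : R, 0 < e -> \forall k \near W, d (u k) p < e.

(** This is how properness enters the metric part; [qh_bounded_ultralimit] provides it for the
    quasihyperbolic metric. *)
Context (bounded_ultralimit : forall (u : nat -> X) x (r : R),
  (\forall k \near W, d x (u k) <= r) -> exists p, ultralimit u p).

Lemma d_ge0 x y : 0 <= d x y.
Proof. by have := dtri x y x; rewrite dxx (dC y); lra. Qed.

Lemma ultralimit_cst x : ultralimit (fun=> x) x.
Proof. by move=> e e0; near=> k; rewrite dxx. Unshelve. all: by end_near. Qed.

Lemma ultralimit_dist_le u v p q a : ultralimit u p -> ultralimit v q ->
  (forall e : R, 0 < e -> \forall k \near W, d (u k) (v k) <= a + e) -> d p q <= a.
Proof.
move=> up vq uv; apply/ler_addgt0Pr => e e0.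
have e3 : 0 < e / 3 by lra.
near W => k.
have : d (u k) p < e / 3 by near: k; exact: up.
have : d (v k) q < e / 3 by near: k; exact: vq.
have : d (u k) (v k) <= a + e / 3 by near: k; exact: uv.
have := dtri p (u k) q; have := dtri (u k) (v k) q; rewrite (dC p (u k)); lra.
Unshelve. all: by end_near. Qed.

Lemma ultralimit_dist_ge u v p q a : ultralimit u p -> ultralimit v q ->
  (forall e : R, 0 < e -> \forall k \near W, a - e <= d (u k) (v k)) -> a <= d p q.
Proof.
move=> up vq uv; apply/ler_addgt0Pr => e e0.
have e3 : 0 < e / 3 by lra.
near W => k.
have : d (u k) p < e / 3 by near: k; exact: up.
have : d (v k) q < e / 3 by near: k; exact: vq.
have : a - e / 3 <= d (u k) (v k) by near: k; exact: uv.
have := dtri (u k) p (v k); have := dtri p q (v k); rewrite (dC q (v k)); lra.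
Unshelve. all: by end_near. Qed.

Lemma ultralimit_dist u v p q a : ultralimit u p -> ultralimit v q ->
  (\forall k \near W, d (u k) (v k) = a) -> d p q = a.
Proof.
move=> up vq uv; apply/eqP; rewrite eq_le; apply/andP; split.
  apply: (ultralimit_dist_le up vq) => e e0; near=> k.
  by rewrite (near uv k _)//; lra.
apply: (ultralimit_dist_ge up vq) => e e0; near=> k.
by rewrite (near uv k _)//; lra.
Unshelve. all: by end_near. Qed.

Lemma ultralimit_unique u p q : ultralimit u p -> ultralimit u q -> p = q.
Proof.
move=> up uq; apply: dsep; apply: (ultralimit_dist up uq).
by near=> k; rewrite dxx.
Unshelve. all: by end_near. Qed.

(** The ultralimit of approximate geodesics is 1-Lipschitz on an interval of length [d x y] and
    joins [x] to [y]. Such a curve is a geodesic: by the triangle inequality, a shortening between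
    two parameters would make [x] and [y] closer than [d x y]. *)
Lemma geodesic_of_approx_geodesics x y :
  (forall e : R, 0 < e -> exists c : R -> X, [/\ c 0 = x, c (d x y) = y &
    forall s t : R, 0 <= s -> s <= t -> t <= d x y -> d (c s) (c t) <= t - s + e]) ->
  exists c : R -> X, [/\ geodesic d (d x y) c, c 0 = x & c (d x y) = y].
Proof.
move=> app; set L := d x y.
have L0 : 0 <= L := d_ge0 x y.
have /choice[c cP] : forall k : nat, exists c : R -> X, [/\ c 0 = x, c L = y &
    forall s t : R, 0 <= s -> s <= t -> t <= L ->
    d (c s) (c t) <= t - s + k.+1%:R^-1].
  by move=> k; apply: app; rewrite invr_gt0.
have eW (e : R) : 0 < e -> \forall k \near W, k.+1%:R^-1 < e.
  by move=> e0; apply: Wfree; exact: (near_infty_natSinv_lt (PosNum e0)).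
have /choice[g gP] (t : R) : exists p, 0 <= t -> t <= L -> ultralimit (c ^~ t) p.
  have [t0|] := leP 0 t; last by exists x.
  have [tL|] := leP t L; last by exists x.
  have [|p pP] := @bounded_ultralimit (c ^~ t) x (t + 1).
    near=> k; have [cx _ /(_ 0 t)] := cP k; rewrite cx subr0.
    move=> /(_ (lexx _) t0 tL) /le_trans; apply; rewrite lerD2l.
    by apply: ltW; near: k; exact: eW.
  by exists p.
have g0 : g 0 = x.
  apply: (ultralimit_unique (gP 0 (lexx _) L0)) => e e0; near=> k.
  by have [-> _ _] := cP k; rewrite dxx.
have gL : g L = y.
  apply: (ultralimit_unique (gP L L0 (lexx _))) => e e0; near=> k.
  by have [_ -> _] := cP k; rewrite dxx.
have glip (s t : R) : 0 <= s -> s <= t -> t <= L -> d (g s) (g t) <= t - s.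
  move=> s0 st tL; apply: (ultralimit_dist_le (gP s _ _) (gP t _ _)) => //.
  - exact: le_trans tL.
  - exact: le_trans st.
  move=> e e0; near=> k; have [_ _ /(_ s t s0 st tL) /le_trans] := cP k.
  by apply; rewrite lerD2l; apply: ltW; near: k; exact: eW.
exists g; split => //.
have gd (s t : R) : 0 <= s -> s <= t -> t <= L -> d (g s) (g t) = t - s.
  move=> s0 st tL; apply/eqP; rewrite eq_le glip//=.
  have := glip 0 s (lexx _) s0 (le_trans st tL).
  have := glip t L (le_trans s0 st) tL (lexx _).
  have := dtri x (g s) y; have := dtri (g s) (g t) y.
  rewrite g0 gL -/L; lra.
move=> s t /=; rewrite !in_itv/= => /andP[s0 sL] /andP[t0 tL].
have [st|/ltW ts] := leP s t.
  by rewrite gd// distrC ger0_norm// subr_ge0.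
by rewrite dC gd// ger0_norm// subr_ge0.
Unshelve. all: by end_near. Qed.

Lemma increasing_choice (P : nat -> nat -> Prop) :
  (forall m N : nat, exists2 k, (N <= k)%N & P m k) ->
  exists2 f : nat -> nat, {homo f : i j / (i < j)%N} & forall m, P m (f m).
Proof.
move=> h; have /choice[G GP] : forall mN : nat * nat,
    exists k, (mN.2 <= k)%N /\ P mN.1 k.
  by move=> [m N]; have [k ? ?] := h m N; exists k.
pose f := fix f m := if m is m'.+1 then G (m, (f m').+1) else G (0%N, 0%N).
exists f; last first.
  by case=> [|m]; [exact: (GP (0%N, 0%N)).2|exact: (GP (m.+1, (f m).+1)).2].
apply: homo_ltn; first exact: ltn_trans.
by move=> i; exact: (GP (i.+1, (f i).+1)).1.
Qed.

(* The subsequence is read off from the pointwise ultralimit: the m-th index is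
   chosen so that the m-th curve is close to the limit on a finite grid. *)
Lemma ultralimit_curves (c : nat -> R -> X) o : (forall k, c k 0 = o) ->
  (forall k (s t : R), 0 <= s -> 0 <= t -> d (c k s) (c k t) <= `|s - t|) ->
  exists2 g : R -> X, forall t, 0 <= t -> ultralimit (c ^~ t) (g t) &
    exists2 f : nat -> nat, {homo f : i j / (i < j)%N} &
      cvg_on_compacts d (c \o f) g.
Proof.
move=> c0 clip.
have /choice[g gP] (t : R) : exists p, 0 <= t -> ultralimit (c ^~ t) p.
  have [t0|] := leP 0 t; last by exists o.
  have [|p pP] := @bounded_ultralimit (c ^~ t) o t; last by exists p.
  near=> k; rewrite -(c0 k); apply: le_trans (clip _ _ _ _ _) _ => //.
  by rewrite sub0r normrN ger0_norm.
exists g => //.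
have glip (s t : R) : 0 <= s -> 0 <= t -> d (g s) (g t) <= `|s - t|.
  move=> s0 t0; apply: (ultralimit_dist_le (gP s s0) (gP t t0)) => e e0.
  by near=> k; apply: le_trans (clip _ _ _ s0 t0) _; lra.
(* For i up to the square of m + 1 these nodes cover [0, m + 1] with mesh 1 / (m + 1), so that the
   range and the fineness of the grid grow together. *)
pose node (m i : nat) : R := i%:R / m.+1%:R.
have [|f fi fP] := @increasing_choice (fun m k => forall i, (i <= m.+1 * m.+1)%N ->
    d (c k (node m i)) (g (node m i)) < m.+1%:R^-1).
  move=> m N.
  have : \forall k \near W, (N <= k)%N /\ forall i : 'I_(m.+1 * m.+1).+1,
      d (c k (node m i)) (g (node m i)) < m.+1%:R^-1.
    apply: filterI; first by apply: Wfree; exact: nbhs_infty_ge.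
    apply: filter_forall => i; apply: gP; last by rewrite invr_gt0.
    by rewrite divr_ge0.
  move=> /filter_ex[k [Nk kP]]; exists k => // i im.
  by have := kP (Ordinal (im : (i < (m.+1 * m.+1).+1)%N)).
exists f => // M e e0; have e3 : 0 < e / 3 by lra.
near=> m => /= t /andP[t0 tM] /=.
have m0 : 0 < m.+1%:R :> R by [].
have me : m.+1%:R^-1 < e / 3.
  by near: m; exact: (near_infty_natSinv_lt (PosNum e3)).
have Mm : M <= m.+1%:R.
  have : (Num.truncn M <= m)%N by near: m; exact: nbhs_infty_ge.
  have [M0 Mm|M0 _] := leP 0 M; last by rewrite (le_trans (ltW M0)).
  by have /andP[_ /ltW/le_trans] := truncn_itv M0; apply; rewrite ler_nat ltnS.
pose i := Num.truncn (t * m.+1%:R).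
have /andP[it ti] : i%:R <= t * m.+1%:R < i.+1%:R.
  by apply: truncn_itv; rewrite mulr_ge0.
have im : (i <= m.+1 * m.+1)%N.
  rewrite -(ler_nat R) natrM (le_trans it)// ler_pM2r//.
  exact: le_trans Mm.
have n0 : 0 <= node m i by rewrite divr_ge0.
have nt : `|t - node m i| <= m.+1%:R^-1.
  rewrite ger0_norm; last by rewrite subr_ge0 ler_pdivrMr.
  rewrite lerBlDr /node -[X in X + _]mul1r -mulrDl ler_pdivlMr// nat1r.
  exact: ltW.
have := dtri (c (f m) t) (c (f m) (node m i)) (g t).
have := dtri (c (f m) (node m i)) (g (node m i)) (g t).
have := clip (f m) t (node m i) t0 n0; have := glip (node m i) t n0 t0.
rewrite distrC; have := fP m i im.
move: (node m i) (m.+1%:R^-1) me nt => u h me nt.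
lra.
Unshelve. all: by end_near. Qed.

(** * The Gromov compactification *)

Context (dgeod : forall x y, exists c : R -> X,
  [/\ geodesic d (d x y) c, c 0 = x & c (d x y) = y]).

Lemma segment_ray o (x y : X) : exists c : R -> X,
  [/\ c 0 = x, geodesic d (d x y) c &
      generalized_ray_to c (gromov_pt y : gromov_compactification d o)].
Proof.
have [c [cg c0 cd]] := dgeod x y.
have L0 := d_ge0 x y.
exists (fun t => if t <= d x y then c t else y); split => //.
- by rewrite L0.
- move=> s t /=; rewrite !in_itv/= => /andP[s0 sL] /andP[t0 tL].
  by rewrite sL tL cg//= in_itv/= ?s0 ?t0.
exists (d x y); split => //.
- move=> s t /=; rewrite !in_itv/= => /andP[s0 sL] /andP[t0 tL].
  by rewrite sL tL cg//= in_itv/= ?s0 ?t0.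
- move=> t; rewrite le_eqVlt => /predU1P[<-|]; first by rewrite lexx.
  by rewrite leNgt => ->.
Qed.

(** Extending a segment by a constant keeps it 1-Lipschitz, which is the equicontinuity that
    [ultralimit_curves] needs, wherever the generalized ray ends. *)
Lemma generalized_ray_lipschitz o c (x : gromov_compactification d o) (s t : R) :
  generalized_ray_to c x -> 0 <= s -> 0 <= t -> d (c s) (c t) <= `|s - t|.
Proof.
case: x => [p [T [T0 cg cT]]|xi [cg _]] s0 t0; last first.
  by rewrite cg//= in_itv/= ?s0 ?t0.
wlog st : s t s0 t0 / s <= t.
  move=> h; have [/h|/ltW ts] := leP s t; first exact.
  by rewrite distrC dC h.
have [tT|/ltW Tt] := leP t T.
  by rewrite cg//= in_itv/= ?s0 ?t0//= (le_trans st).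
rewrite (cT t Tt) distrC ger0_norm ?subr_ge0//.
have [sT|/ltW Ts] := leP s T; last by rewrite cT// dxx subr_ge0.
rewrite -(cT T)// cg//= ?in_itv/= ?s0 ?T0 ?lexx// distrC ger0_norm ?subr_ge0//.
by rewrite lerD2r.
Qed.

Lemma ultralimit_ray (c : nat -> R -> X) (g : R -> X) :
  (forall t, 0 <= t -> ultralimit (c ^~ t) (g t)) ->
  (forall M, \forall k \near W, geodesic d M (c k)) -> geodesic_ray d g.
Proof.
move=> cg cM s t /=; rewrite !in_itv/= !andbT => s0 t0.
apply: (ultralimit_dist (cg s s0) (cg t t0)).
near=> k; apply: (near (cM (Num.max s t)) k _) => //=;
  by rewrite in_itv/= ?s0 ?t0/= le_max lexx ?orbT.
Unshelve. all: by end_near. Qed.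

Lemma asymptotic_sym c c' : asymptotic d c c' -> asymptotic d c' c.
Proof. by move=> [M cM]; exists M => t t0; rewrite dC cM. Qed.

Lemma asymptotic_trans c c' c'' :
  asymptotic d c c' -> asymptotic d c' c'' -> asymptotic d c c''.
Proof.
move=> [M cM] [N cN]; exists (M + N) => t t0.
by rewrite (le_trans (dtri _ (c' t) _))// lerD ?cM ?cN.
Qed.

Lemma gromov_boundary_memP (xi : gromov_boundary d) c c' : \val xi c ->
  \val xi c' <-> geodesic_ray d c' /\ asymptotic d c c'.
Proof.
case: xi => xi /=; rewrite inE => -[b bg ->] [cg bc]; split => -[c'g bc'].
  by split => //; apply: asymptotic_trans bc'; exact: asymptotic_sym.
by split => //; apply: asymptotic_trans bc'.
Qed.

Lemma gromov_boundary_eq (xi eta : gromov_boundary d) c :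
  \val xi c -> \val eta c -> xi = eta.
Proof.
move=> xic etac; apply: val_inj; apply/seteqP; split => c'.
  by move=> /(gromov_boundary_memP _ xic)/(gromov_boundary_memP _ etac).
by move=> /(gromov_boundary_memP _ etac)/(gromov_boundary_memP _ xic).
Qed.

Lemma ray_end c : geodesic_ray d c -> exists xi : gromov_boundary d, \val xi c.
Proof.
move=> cg.
have xiP : [set c' | geodesic_ray d c' /\ asymptotic d c c'] \in gromov_boundary d.
  by rewrite inE; exists c.
exists (exist (fun x => x \in gromov_boundary d) _ xiP) => /=; split => //.
exists 0 => t _.
by rewrite dxx.
Qed.

Lemma gromov_boundary_inhabited (xi : gromov_boundary d) :
  exists c, geodesic_ray d c /\ \val xi c.
Proof.
case: xi => xi /=; rewrite inE => -[c cg ->]; exists c; do ?split => //.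
by exists 0 => t _; rewrite dxx.
Qed.

(** * Rays, lines and sequential compactness in hyperbolic spaces *)

Context (dhyp : gromov_hyperbolic d).

(* The four-point inequality at o, x, q, y, with x and y at the same time t on
   geodesics [o, q] and [p, q]. *)
Lemma geodesics_fellow_travel : exists2 del : R, 0 <= del &
  forall o p q x y t, d o x = t -> d x q = d o q - t ->
  d p y = t -> d y q = d p q - t -> d x y <= d o p + del.
Proof.
have [del del0 hyp] := dhyp; exists (2 * del) => [|o p q x y t ox xq py yq].
  by rewrite mulr_ge0.
(* At [o], the product of [x] and [q] is [t]. When the minimum is the product of [q] and [y], the
   term [d y o] cancels against the one in the product of [x] and [y]; thus [d o p] is paid only
   once in both cases. *)
have := hyp o x q y; rewrite /gromov_product lerBlDr ge_min.
rewrite xq (dC x o) ox (dC q o) (dC q y) yq.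
have := dtri o p q; have := dtri p o q; have := dtri p o y; have := dtri o p y.
rewrite (dC y o) (dC p o) py.
by move=> ? ? ? ? /orP[]; lra.
Qed.

(** The segment [c k] and the piece of [b] up to [tau k] share their final point and start within
    [D] of each other, so they fellow-travel with a bound independent of [k] and of the time, which
    passes to the ultralimit. *)
Lemma ultralimit_asymptotic (c : nat -> R -> X) (T tau : nat -> R) (b g : R -> X)
    (D : R) : geodesic_ray d b ->
  (forall M : R, \forall k \near W, M <= T k) ->
  (\forall k \near W, [/\ geodesic d (T k) (c k), 0 <= tau k,
     c k (T k) = b (tau k) & d (c k 0) (b 0) <= D]) ->
  (forall t : R, 0 <= t -> ultralimit (c ^~ t) (g t)) ->
  asymptotic d b g.
Proof.
move=> bg Tk ck cg; have [del del0 fellow] := geodesics_fellow_travel.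
exists (D + del) => t t0.
apply: (ultralimit_dist_le (ultralimit_cst (b t)) (cg t t0)) => e e0.
near=> k; rewrite dC.
have [ckg tauk ckT D0] : [/\ geodesic d (T k) (c k), 0 <= tau k,
     c k (T k) = b (tau k) & d (c k 0) (b 0) <= D] by near: k.
(* The lengths [T k] and [tau k] differ by at most [D], so this also gives [t <= tau k]. *)
have Tt : t + D <= T k by near: k; exact: Tk.
have Dge0 : 0 <= D := le_trans (d_ge0 _ _) D0.
have Tk0 : 0 <= T k by lra.
have tT : t <= T k by lra.
have bd u v : 0 <= u -> u <= v -> d (b u) (b v) = v - u.
  move=> u0 uv; rewrite bg/= ?in_itv/= ?u0 ?(le_trans u0)//.
  by rewrite distrC ger0_norm// subr_ge0.
have cd u v : 0 <= u -> u <= v -> v <= T k -> d (c k u) (c k v) = v - u.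
  move=> u0 uv vT; rewrite ckg/= ?in_itv/= ?u0 ?(le_trans u0) ?(le_trans uv)//.
  by rewrite distrC ger0_norm// subr_ge0.
have tautT : t <= tau k.
  have := dtri (c k 0) (b 0) (b (tau k)); rewrite -{1}ckT cd// bd//; lra.
have ct : d (c k 0) (c k t) = t by rewrite cd// subr0.
have := fellow (c k 0) (b 0) (b (tau k)) (c k t) (b t) t ct.
rewrite -{1 2}ckT !cd// !subr0 !bd// !subr0 => /(_ erefl erefl erefl).
lra.
Unshelve. all: by end_near. Qed.

(** The subsequence [f] is arbitrary, as in the definition of [gromov_cvg]. The segments from [o] to
    points escaping along [b] have lengths tending to infinity, so their limit is a ray, and they
    end on [b], so this ray is asymptotic to [b]. *)
Lemma segment_limits o (b : R -> X) (t : nat -> R) (c : nat -> R -> X)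
    (f : nat -> nat) : geodesic_ray d b ->
  (forall M : R, \forall k \near \oo, M <= t k) ->
  (forall k, c k 0 = o /\
    generalized_ray_to (c k) (gromov_pt (b (t k)) : gromov_compactification d o)) ->
  {homo f : i j / (i < j)%N} ->
  exists2 h : nat -> nat, {homo h : i j / (i < j)%N} &
    exists g : R -> X, [/\ g 0 = o, geodesic_ray d g, asymptotic d b g &
      cvg_on_compacts d (c \o f \o h) g].
Proof.
move=> bg tk ck fi.
have [|k s s' s0 s'0|g cg [h hi ch]] := @ultralimit_curves (c \o f) o.
- by move=> k; case: (ck (f k)).
- by have [_ /generalized_ray_lipschitz] := ck (f k); exact.
exists h => //; exists g.
have /choice[T TP] k : exists T, [/\ 0 <= T, geodesic d T (c k) &
    forall t', T <= t' -> c k t' = b (t k)] by have [_ []] := ck k; eauto.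
have fk : (forall M : R, \forall k \near W, M <= t (f k)).
  move=> M; apply: Wfree; have [N _ NP] := tk M; exists N => // k /= Nk.
  by apply: NP => /=; apply: leq_trans Nk _; exact: leq_increasing.
have Td k : d o (b (t k)) = T k.
  have [c0 _] := ck k; have [T0 cg' cT] := TP k.
  rewrite -c0 -(cT (T k))// cg'/= ?in_itv/= ?T0 ?lexx//.
  by rewrite sub0r normrN ger0_norm.
(* The triangle inequality gives [t (f k) <= T (f k) + d o (b 0)]. *)
have TW (M : R) : \forall k \near W, M <= T (f k).
  near=> k.
  have Mt : M + d o (b 0) <= t (f k) by near: k; exact: fk.
  have t0 : 0 <= t (f k) by near: k; exact: fk.
  have := dtri (b 0) o (b (t (f k))); rewrite Td (dC (b 0) o).
  rewrite bg/= ?in_itv/= ?lexx ?t0// sub0r normrN ger0_norm//; lra.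
split => //.
- apply: (ultralimit_unique (cg 0 (lexx _))).
  by move=> e e0; near=> k => /=; have [-> _] := ck (f k); rewrite dxx.
- apply: (ultralimit_ray cg) => M; near=> k => s s' /=.
  rewrite !in_itv/= => /andP[s0 sM] /andP[s'0 s'M].
  have MT : M <= T (f k) by near: k; exact: TW.
  have [_ cg' _] := TP (f k).
  by apply: cg'; rewrite /= in_itv/= ?s0 ?s'0/=; lra.
- apply: (@ultralimit_asymptotic (c \o f) (T \o f) (t \o f) b g (d o (b 0))) => //.
  near=> k => /=; have [T0 cg' cT] := TP (f k); have [-> _] := ck (f k).
  by split => //; [near: k; exact: fk|exact: cT].
Unshelve. all: by end_near. Qed.

Lemma ray_cvg o (b : R -> X) (t : nat -> R) (xi : gromov_boundary d) :
  geodesic_ray d b -> \val xi b -> (forall M : R, \forall k \near \oo, M <= t k) ->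
  gromov_cvg (fun k => gromov_pt (b (t k)) : gromov_compactification d o)
    (gromov_infty xi).
Proof.
move=> bg xib tk.
have /choice[c cP] k : exists c : R -> X, c 0 = o /\ generalized_ray_to c
    (gromov_pt (b (t k)) : gromov_compactification d o).
  by have [c [c0 _ cr]] := segment_ray o o (b (t k)); exists c.
exists c => // f fi.
have [h hi [g [g0 gr bgr cg]]] := segment_limits bg tk cP fi.
exists h => //; exists g; split => //; split => //.
exact/(gromov_boundary_memP _ xib).
Qed.

(** The limit ray that witnesses the convergence of the points [b k] starts at the base point, so a
    representative from [o] is read off from [ray_cvg]. *)
Lemma ray_from o (xi : gromov_boundary d) :
  exists c, [/\ c 0 = o, geodesic_ray d c & \val xi c].
Proof.
have [b [bg xib]] := gromov_boundary_inhabited xi.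
have tk : forall M : R, \forall k \near \oo, M <= k%:R := near_le_natr.
have [c _ /(_ id (fun _ _ => id))[f _ [g [g0 [gr xig] _]]]] := ray_cvg o bg xib tk.
by exists g.
Qed.

(* Either the domains of the generalized rays have a bound M for W-many indices,
   and then the limit ends at g M, or the limit is a geodesic ray. *)
Lemma ultralimit_generalized_ray o (u : nat -> gromov_compactification d o)
    (c : nat -> R -> X) (g : R -> X) :
  (forall k, c k 0 = o /\ generalized_ray_to (c k) (u k)) ->
  (forall t : R, 0 <= t -> ultralimit (c ^~ t) (g t)) ->
  exists x : gromov_compactification d o, generalized_ray_to g x.
Proof.
move=> cu cg.
have clip k (s t : R) : 0 <= s -> 0 <= t -> d (c k s) (c k t) <= `|s - t|.
  by have [_ /generalized_ray_lipschitz] := cu k; exact.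
(* These are the indices whose generalized ray has stopped by time [M]. If no [B M] is in [W], then
   every complement is, and the limit is geodesic on each [0, M]. *)
pose B M := [set k | exists T, [/\ 0 <= T <= M, geodesic d T (c k) &
  forall t, T <= t -> c k t = c k T]].
have [[M BM]|nB] := pselect (exists M, W (B M)); last first.
  have [|xi xig] := @ray_end g; last first.
    exists (gromov_infty xi); split => //.
    by case: xi xig => xi /=; rewrite inE => -[? ? ->] [].
  apply: (ultralimit_ray cg) => M.
  have [BM|] := in_ultra_setVsetC (B M) Wultra; first by case: nB; exists M.
  apply: filterS => k nBk; have [_] := cu k.
  case: (u k) => [p [T [T0 ckg cT]]|xi [ckg _]] s t /=;
    rewrite !in_itv/= => /andP[s0 sM] /andP[t0 tM].
    have [TM|/ltW MT] := leP T M.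
      by case: nBk; exists T; split; rewrite ?T0// => t' Tt'; rewrite !cT.
    by rewrite ckg//= in_itv/= ?s0 ?t0/= (le_trans _ MT).
  by rewrite ckg//= in_itv/= ?s0 ?t0.
have /choice[T TP] k : exists T : R, B M k -> [/\ 0 <= T <= M, geodesic d T (c k) &
  forall t, T <= t -> c k t = c k T].
  by have [[T ?]|] := pselect (B M k); [exists T|exists 0].
have M0 : 0 <= M.
  by have [k /TP[/andP[T0 TM] _ _]] := filter_ex BM; exact: le_trans TM.
have cd k s t : B M k -> 0 <= s -> s <= t -> t <= T k ->
    d (c k s) (c k t) = t - s.
  move=> /TP[_ ckg _] s0 st tT.
  rewrite ckg/= ?in_itv/= ?s0 ?(le_trans s0)// ?(le_trans st)//.
  by rewrite distrC ger0_norm// subr_ge0.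
(* On [B M] the point [c k M] is at distance [T k] from [o], so [S] is the limit of the lengths
   [T k] along [W]. *)
pose S := d o (g M).
have TS (e : R) : 0 < e -> \forall k \near W, [/\ B M k, T k < S + e & S - e < T k].
  move=> e0; near=> k.
  have Bk : B M k by near: k.
  have [/andP[T0 TM] ckg cT] := TP _ Bk; have [c0 _] := cu k.
  have : d (c k M) (g M) < e by near: k; exact: cg.
  have := cd k 0 (T k) Bk (lexx _) T0 (lexx _); rewrite c0 subr0 -(cT M)//.
  have := dtri o (c k M) (g M); have := dtri o (g M) (c k M).
  rewrite -/S (dC (g M) (c k M)); split => //; lra.
exists (gromov_pt (g M)), S; split; first exact: d_ge0.
- move=> s t /=; rewrite !in_itv/=.
  wlog st : s t / s <= t.
    move=> h sS tS; have [st|/ltW ts] := leP s t; first exact: h.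
    by rewrite dC distrC h.
  move=> /andP[s0 sS] /andP[t0 tS]; rewrite distrC ger0_norm ?subr_ge0//.
  apply/eqP; rewrite eq_le; apply/andP; split.
    apply: (ultralimit_dist_le (cg s s0) (cg t t0)) => e e0.
    near=> k; have := clip k s t s0 t0.
    by rewrite distrC ger0_norm ?subr_ge0//; lra.
  apply: (ultralimit_dist_ge (cg s s0) (cg t t0)) => e e0.
  near=> k; have [Bk TSk STk] : [/\ B M k, T k < S + e & S - e < T k].
    by near: k; exact: TS.
  have [/andP[T0 TM] ckg cT] := TP _ Bk.
  have [tT|/ltW Tt] := leP t (T k); first by rewrite cd//; lra.
  rewrite (cT t Tt); have [sT|/ltW Ts] := leP s (T k); first by rewrite cd//; lra.
  by have := d_ge0 (c k s) (c k (T k)); lra.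
- move=> t St; apply: dsep; apply/eqP; rewrite eq_le d_ge0 andbT.
  have t0 : 0 <= t := le_trans (d_ge0 _ _) St.
  apply: (ultralimit_dist_le (cg t t0) (cg M M0)) => e e0; near=> k.
  have [Bk TSk STk] : [/\ B M k, T k < S + e & S - e < T k].
    by near: k; exact: TS.
  have [/andP[T0 TM] ckg cT] := TP _ Bk; rewrite (cT M TM).
  have [Tt|/ltW tT] := leP (T k) t; first by rewrite (cT t)// dxx; lra.
  by rewrite cd//; lra.
Unshelve. all: by end_near. Qed.

Lemma gromov_seq_compact o (u : nat -> gromov_compactification d o) :
  exists2 f : nat -> nat, {homo f : i j / (i < j)%N} &
    exists x, gromov_cvg (u \o f) x.
Proof.
have /choice[c cP] k : exists c : R -> X, c 0 = o /\ generalized_ray_to c (u k).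
  case: (u k) => [p|xi].
    by have [c [c0 _ cr]] := segment_ray o o p; exists c.
  by have [c [c0 cr xic]] := ray_from o xi; exists c.
have [|k s t s0 t0|g cg [f fi cfg]] := @ultralimit_curves c o.
- by move=> k; case: (cP k).
- by have [_ /generalized_ray_lipschitz] := cP k; exact.
have [x gx] := ultralimit_generalized_ray cP cg.
exists f => //; exists x, (c \o f) => [k|phi phii]; first exact: cP.
(* [c \o f] converges as a whole, so no further extraction is needed. *)
exists id => //; exists g; split => //.
  apply: (ultralimit_unique (cg 0 (lexx _))) => e e0; near=> k.
  by have [-> _] := cP k; rewrite dxx.
move=> M e e0; have [N _ NP] := cfg M e e0; exists N => // k /= Nk.
by apply: NP => /=; apply: leq_trans Nk _; exact: leq_increasing.
Unshelve. all: by end_near. Qed.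

(** If the products are unbounded, choose [k] where the product exceeds [t]; this forces [t <= k].
    The four-point inequality, applied along [c t], [c k], [c' k], [c' t], bounds the product at
    time [t] below by [t - 2 * del], which says that [c t] and [c' t] are within [4 * del]. *)
Lemma divergent_rays_product_bounded (o : X) c c' : c 0 = o -> c' 0 = o ->
  geodesic_ray d c -> geodesic_ray d c' -> ~ asymptotic d c c' ->
  exists A : R, forall t : R, 0 <= t -> gromov_product d o (c t) (c' t) <= A.
Proof.
move=> c0 c'0 cg c'g nas; apply: contrapT => nA; apply: nas.
have [del del0 hyp] := dhyp; exists (4 * del) => t t0.
have [k k0 tk] : exists2 k : R, 0 <= k & t < gromov_product d o (c k) (c' k).
  apply: contrapT => nk; apply: nA; exists t => k k0.
  by rewrite leNgt; apply/negP => tk; apply: nk; exists k.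
have rayd (b : R -> X) (s v : R) : geodesic_ray d b -> 0 <= s -> s <= v ->
    d (b s) (b v) = v - s.
  move=> bg s0 sv; rewrite bg/= ?in_itv/= ?s0 ?(le_trans s0)//.
  by rewrite distrC ger0_norm// subr_ge0.
have co (b : R -> X) (s : R) : geodesic_ray d b -> b 0 = o -> 0 <= s ->
    d (b s) o = s.
  by move=> bg b0 s0; rewrite dC -b0 rayd// subr0.
have tlek : t <= k.
  have := d_ge0 (c k) (c' k); move: tk; rewrite /gromov_product !co//.
  lra.
have := hyp o (c t) (c k) (c' t); have := hyp o (c k) (c' k) (c' t).
move: tk; rewrite /gromov_product !co// (dC (c' k) (c' t)) !(rayd _ t k)//.
rewrite !lerBlDr !ge_min => tk /orP[] h1 /orP[] h2; lra.
Qed.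

(* The midpoints of the segments from c k to c' k stay at bounded distance of o,
   since the Gromov products of c k and c' k are bounded. *)
Lemma geodesic_line_between (o : X) (xi eta : gromov_boundary d) : xi <> eta ->
  exists g : R -> X, [/\ geodesic_line d g,
    \val xi (g \o -%R) & \val eta g].
Proof.
move=> xieta.
have [c [c0 cg xic]] := ray_from o xi.
have [c' [c'0 c'g etac']] := ray_from o eta.
have nas : ~ asymptotic d c c'.
  move=> as_; apply: xieta; apply: (gromov_boundary_eq _ etac').
  exact/(gromov_boundary_memP _ xic).
have [A AP] := divergent_rays_product_bounded c0 c'0 cg c'g nas.
have /choice[s sP] (k : nat) := dgeod (c k%:R) (c' k%:R).
(* The half length [l k] shifts the segment so that [q k] has its midpoint at time 0. *)
pose l k := d (c k%:R) (c' k%:R) / 2.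
pose q k t := s k (l k + t).
have co (b : R -> X) (t : R) : geodesic_ray d b -> b 0 = o -> 0 <= t ->
    d (b t) o = t.
  by move=> bg b0 t0; rewrite -b0 bg ?subr0 ?ger0_norm//= in_itv/= ?t0 ?lexx.
have nW (M : R) : \forall k \near W, M <= k%:R.
  by apply: Wfree; exact: near_le_natr.
(* [l k] is [k] minus the Gromov product of [c k] and [c' k], which is at most [A]. *)
have lW (M : R) : \forall k \near W, M <= l k.
  near=> k; have := AP k%:R (ler0n _ _); rewrite /gromov_product !co// -/(l k).
  have : M + A <= k%:R by near: k; exact: nW.
  rewrite /l; lra.
have l0 k : 0 <= l k by rewrite divr_ge0// d_ge0.
have qd k t t' : - l k <= t <= l k -> - l k <= t' <= l k ->
    d (q k t) (q k t') = `|t - t'|.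
  move=> /andP[t1 t2] /andP[t'1 t'2]; have [sg _ _] := sP k.
  have l2 : d (c k%:R) (c' k%:R) = 2 * l k by rewrite /l; lra.
  rewrite sg/= ?in_itv/= ?l2; first by congr `| _ |; lra.
  - by apply/andP; split; lra.
  - by apply/andP; split; lra.
have qc k : q k (- l k) = c k%:R by rewrite /q subrr; case: (sP k).
have qc' k : q k (l k) = c' k%:R.
  by rewrite /q -splitr; case: (sP k).
have [del del0 hyp] := dhyp.
(* Let P be the product of [c k] and [c' k], and r the distance from the midpoint to [o]. The
   product of the midpoint with either endpoint is (P + r) / 2, so the four-point inequality gives r
   at most P + 2 del. *)
pose D := A + 2 * del.
have qo k : d (q k 0) o <= D.
  have lk := l0 k.
  have b1 : - l k <= - l k <= l k by apply/andP; split; lra.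
  have b2 : - l k <= 0 <= l k by apply/andP; split; lra.
  have b3 : - l k <= l k <= l k by apply/andP; split; lra.
  have := qd k _ _ b1 b2; rewrite qc subr0 normrN ger0_norm// => e1.
  have := qd k _ _ b2 b3; rewrite qc' sub0r normrN ger0_norm// => e2.
  have e3 : d (c k%:R) (c' k%:R) = 2 * l k by rewrite /l; lra.
  have := AP k%:R (ler0n _ _); have := hyp o (c k%:R) (q k 0) (c' k%:R).
  rewrite /gromov_product (co c)// (co c')// e1 e2 e3 /D lerBlDr ge_min.
  by move=> /orP[]; lra.
have /choice[g gP] (t : R) : exists p, ultralimit (q ^~ t) p.
  apply: (@bounded_ultralimit _ o (D + `|t|)); near=> k.
  have : `|t| <= l k by near: k; exact: lW.
  rewrite ler_norml => tl.
  have b0 : - l k <= 0 <= l k by rewrite oppr_le0 l0.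
  have := dtri o (q k 0) (q k t); rewrite (dC o (q k 0)) (qd k _ _ b0 tl).
  by rewrite sub0r normrN; have := qo k; lra.
exists g.
have gline : geodesic_line d g.
  move=> t t' _ _; apply: (ultralimit_dist (gP t) (gP t')); near=> k.
  apply: qd; rewrite -ler_norml; near: k; exact: lW.
split => //.
- apply/(gromov_boundary_memP _ xic); split.
    by move=> t t' _ _ /=; rewrite gline// -opprD normrN.
  (* The half segment from the midpoint to [c k] ends on the ray [c] and starts within [D] of
     [c 0 = o]. *)
  apply: (@ultralimit_asymptotic (fun k t => q k (- t)) l (fun k => k%:R)
    c _ D) => //.
    near=> k; split => //; rewrite ?qc// ?oppr0 ?c0//.
    move=> t t'; rewrite /= !in_itv/= => /andP[t1 t2] /andP[t'1 t'2].
    rewrite qd; first by rewrite -opprD normrN.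
      by rewrite lerN2 t2 (le_trans _ (l0 k))// oppr_le0.
    by rewrite lerN2 t'2 (le_trans _ (l0 k))// oppr_le0.
- apply/(gromov_boundary_memP _ etac'); split.
    by move=> t t' _ _ /=; rewrite gline.
  apply: (@ultralimit_asymptotic q l (fun k => k%:R) c' _ D) => //.
    near=> k; split => //; rewrite ?qc' ?c'0//.
    move=> t t'; rewrite /= !in_itv/= => /andP[t1 t2] /andP[t'1 t'2].
    by rewrite qd// ?t2 ?t'2 ?andbT (le_trans _ t1, le_trans _ t'1)// oppr_le0.
Unshelve. all: by end_near. Qed.

End Ultralimits.

(** * Euclidean length *)

Section EuclideanDistance.
Context {R : realType} {n : nat}.
Implicit Types x y z : 'rV[R]_n.

Lemma euc_dist_ge0 x y : 0 <= euc_dist x y.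
Proof. exact: sqrtr_ge0. Qed.

Lemma euc_distC x y : euc_dist x y = euc_dist y x.
Proof.
by congr Num.sqrt; apply: eq_bigr => i _; rewrite -sqrrN opprB.
Qed.

Lemma euc_distxx x : euc_dist x x = 0.
Proof.
by rewrite /euc_dist big1 ?sqrtr0// => i _; rewrite subrr expr0n.
Qed.

Lemma euc_dist_sqr x y :
  euc_dist x y ^+ 2 = \sum_i (x ord0 i - y ord0 i) ^+ 2.
Proof. by rewrite sqr_sqrtr// sumr_ge0// => i _; exact: sqr_ge0. Qed.

Lemma euc_dist_coord x y i : `|x ord0 i - y ord0 i| <= euc_dist x y.
Proof.
rewrite -(ler_pXn2r (n := 2))// ?nnegrE// ?euc_dist_ge0//.
rewrite euc_dist_sqr real_normK ?num_real// (bigD1 i)//= lerDl.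
by apply: sumr_ge0 => j _; exact: sqr_ge0.
Qed.

Lemma euc_dist_eq0 x y : euc_dist x y <= 0 -> x = y.
Proof.
move=> xy; apply/rowP => i; apply/eqP; rewrite -subr_eq0 -normr_le0.
exact: le_trans (euc_dist_coord x y i) xy.
Qed.

(** Cauchy-Schwarz: with A and B the two norms, add up 2 A B a_i b_i <= B^2 a_i^2 + A^2 b_i^2 and
    cancel 2 A B. Vanishing norms are treated apart. *)
Lemma sum_mul_le_sqrt (a b : 'I_n -> R) :
  \sum_i a i * b i <= Num.sqrt (\sum_i a i ^+ 2) * Num.sqrt (\sum_i b i ^+ 2).
Proof.
have s0 (f : 'I_n -> R) : 0 <= \sum_i f i ^+ 2.
  by apply: sumr_ge0 => i _; exact: sqr_ge0.
have [/eqP A0|A0] := eqVneq (Num.sqrt (\sum_i a i ^+ 2)) 0.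
  have a0 i : a i = 0.
    move: A0; rewrite sqrtr_eq0 => A0; apply/eqP; rewrite -sqrf_eq0.
    rewrite eq_le sqr_ge0 andbT (le_trans _ A0)// (bigD1 i)//= lerDl.
    by apply: sumr_ge0 => j _; exact: sqr_ge0.
  by rewrite (eqP A0) mul0r big1// => i _; rewrite a0 mul0r.
have [/eqP B0|B0] := eqVneq (Num.sqrt (\sum_i b i ^+ 2)) 0.
  have b0 i : b i = 0.
    move: B0; rewrite sqrtr_eq0 => B0; apply/eqP; rewrite -sqrf_eq0.
    rewrite eq_le sqr_ge0 andbT (le_trans _ B0)// (bigD1 i)//= lerDl.
    by apply: sumr_ge0 => j _; exact: sqr_ge0.
  by rewrite (eqP B0) mulr0 big1// => i _; rewrite b0 mulr0.
set A := Num.sqrt (\sum_i a i ^+ 2) in A0 *.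
set B := Num.sqrt (\sum_i b i ^+ 2) in B0 *.
have Ap : 0 < A by rewrite lt_def A0 sqrtr_ge0.
have Bp : 0 < B by rewrite lt_def B0 sqrtr_ge0.
have A2 : \sum_i a i ^+ 2 = A ^+ 2 by rewrite sqr_sqrtr.
have B2 : \sum_i b i ^+ 2 = B ^+ 2 by rewrite sqr_sqrtr.
have AB : 0 < 2 * (A * B) by rewrite !mulr_gt0.
rewrite -(ler_pM2l AB) mulr_sumr.
apply: (@le_trans _ _ (\sum_i (B ^+ 2 * a i ^+ 2 + A ^+ 2 * b i ^+ 2))).
  apply: ler_sum => i _; have := sqr_ge0 (B * a i - A * b i); nra.
by rewrite big_split/= -!mulr_sumr A2 B2; nra.
Qed.

Lemma euc_dist_triangle x y z : euc_dist x z <= euc_dist x y + euc_dist y z.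
Proof.
rewrite -(ler_pXn2r (n := 2))// ?nnegrE ?addr_ge0 ?euc_dist_ge0//.
rewrite sqrrD !euc_dist_sqr.
have := sum_mul_le_sqrt (fun i => x ord0 i - y ord0 i)
  (fun i => y ord0 i - z ord0 i).
rewrite -/(euc_dist x y) -/(euc_dist y z).
set S := \sum_i (_ * _); move=> h.
suff -> : \sum_i (x ord0 i - z ord0 i) ^+ 2 =
    \sum_i (x ord0 i - y ord0 i) ^+ 2 + S *+ 2 + \sum_i (y ord0 i - z ord0 i) ^+ 2.
  by rewrite lerD2r lerD2l lerMn2r.
rewrite /S -sumrMnl -!big_split/=; apply: eq_bigr => i _.
by rewrite -sqrrD subrKA.
Qed.

Lemma euc_dist_le_sum x y : euc_dist x y <= \sum_i `|x ord0 i - y ord0 i|.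
Proof.
have s0 : 0 <= \sum_i `|x ord0 i - y ord0 i| by exact: sumr_ge0.
rewrite -(ler_pXn2r (n := 2))// ?nnegrE ?euc_dist_ge0// euc_dist_sqr expr2 mulr_suml.
apply: ler_sum => i _; rewrite -real_normK ?num_real// expr2 ler_wpM2l//.
by rewrite (bigD1 i)//= lerDl sumr_ge0.
Qed.

Lemma euc_dist_le_norm x y : euc_dist x y <= n%:R * `|x - y|.
Proof.
apply: le_trans (euc_dist_le_sum x y) _.
rewrite mulr_natl -[X in _ *+ X](card_ord n) -sumr_const; apply: ler_sum => i _.
rewrite [leRHS]/Num.norm /= mx_normrE.
have := le_bigmax_cond 0 (fun ij => `|(x - y) ij.1 ij.2|)
  (isT : xpredT (ord0, i)).
by rewrite /= !mxE.
Qed.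

Lemma norm_le_euc_dist x y : `|x - y| <= euc_dist x y.
Proof.
rewrite [leLHS]/Num.norm /= mx_normrE; apply/bigmax_leP => /=; split.
  exact: euc_dist_ge0.
by move=> [i j] _ /=; rewrite !mxE ord1; exact: euc_dist_coord.
Qed.

Lemma nbhs_euc_dist x (A : set 'rV[R]_n) :
  nbhs x A <-> exists2 e : R, 0 < e & forall y, euc_dist x y < e -> A y.
Proof.
split=> [/nbhs_ballP[e /= e0 eA]|[e e0 eA]].
  exists e => // y xy; apply: eA; rewrite -ball_normE /=.
  exact: le_lt_trans (norm_le_euc_dist x y) xy.
have n0 : 0 < n%:R + 1 :> R by rewrite ltr_wpDl.
apply/nbhs_ballP; exists (e / (n%:R + 1)) => /=; first exact: divr_gt0.
move=> y; rewrite -ball_normE /= => xy; apply: eA.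
apply: le_lt_trans (euc_dist_le_norm x y) _.
move: xy; rewrite ltr_pdivlMr// => /(le_lt_trans _); apply.
by rewrite mulrC ler_wpM2l// lerDl.
Qed.

Lemma cvg_euc_dist {T} {F : set_system T} {FF : Filter F} (f : T -> 'rV[R]_n) x :
  f @ F --> x <-> forall e : R, 0 < e -> \forall t \near F, euc_dist x (f t) < e.
Proof.
split=> [fx e e0|fx A /nbhs_euc_dist[e e0 eA]].
  by apply: (fx [set y | euc_dist x y < e]); apply/nbhs_euc_dist; exists e.
by apply: filterS (fx e e0) => t; exact: eA.
Qed.

End EuclideanDistance.

(** * Length and arclength of curves *)

Section CurveLength.
Context {R : realType} {n : nat}.
Implicit Types (g : R -> 'rV[R]_n) (a b r s t : R) (l : seq R).

Local Notation E := euc_dist.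

(** Here [b] is only the default of [nth] and is never reached, so it may be changed freely when
    partitions of different intervals are compared. *)
Definition polygon_length g a b l : R :=
  \sum_(0 <= i < size l) E (g (nth b (a :: l) i)) (g (nth b (a :: l) i.+1)).

Lemma polygon_length_rcons g a b b' l r :
  polygon_length g a b (rcons l r) =
  polygon_length g a b' l + E (g (last a l)) (g r).
Proof.
rewrite /polygon_length size_rcons big_nat_recr//=; congr (_ + _).
  apply: eq_big_nat => i /andP[_ il].
  rewrite -rcons_cons (set_nth_default b'); last first.
    by rewrite size_rcons /= ltnS leqW// ltnW.
  rewrite !nth_rcons/= ltnS (ltnW il) il.
  by congr (E _ (g _)); exact: set_nth_default.
rewrite -rcons_cons !nth_rcons/= ltnS leqnn ltnn eqxx.
by rewrite (last_nth b).
Qed.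

Lemma polygon_length_le_curve_length g a b b' l : itv_partition a b l ->
  ((polygon_length g a b' l)%:E <= curve_length g a b)%E.
Proof.
move=> abl; apply: ereal_sup_ubound => /=; exists l => //; congr (_%:E).
apply: eq_big_nat => i /andP[_ il].
rewrite (set_nth_default b') ?ltnS ?(ltnW il)//=.
by congr (E _ (g _)); exact: set_nth_default.
Qed.

Lemma curve_length_le g a b (M : \bar R) :
  (forall l, itv_partition a b l -> ((polygon_length g a b l)%:E <= M)%E) ->
  (curve_length g a b <= M)%E.
Proof. by move=> h; apply: ge_ereal_sup => _ [l /h lM <-]. Qed.

Lemma itv_partition_rcons a b l r : itv_partition a b l -> b < r ->
  itv_partition a r (rcons l r).
Proof.
move=> [al /eqP lb] br; rewrite /itv_partition rcons_path al lb last_rcons.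
by split.
Qed.

(** Appending [t] to a partition of [a, s] adds one chord. With [curve_length_extend] as the upper
    bound, this takes the place of additivity of length over adjacent intervals. *)
Lemma curve_length_step g a s t : s <= t ->
  (curve_length g a s + (E (g s) (g t))%:E <= curve_length g a t)%E.
Proof.
rewrite le_eqVlt => /predU1P[->|st]; first by rewrite euc_distxx adde0.
rewrite -leeBrDr//; apply: curve_length_le => l asl; rewrite leeBrDr//.
have /eqP las := asl.2.
rewrite -EFinD -[in E _ _]las -(polygon_length_rcons _ _ s).
by apply: polygon_length_le_curve_length; exact: itv_partition_rcons st.
Qed.

Lemma curve_lengthxx g a : curve_length g a a = 0%E.
Proof.
apply/eqP; rewrite eq_le; apply/andP; split.
  apply: curve_length_le => l /itv_partitionxx ->.
  by rewrite /polygon_length big_nil.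
have h : itv_partition a a [::] by split => /=.
have := polygon_length_le_curve_length g a h.
by rewrite /polygon_length big_nil.
Qed.

Lemma curve_length_ge0 g a b : a <= b -> (0 <= curve_length g a b)%E.
Proof.
move=> ab; have := curve_length_step g a ab; rewrite curve_lengthxx add0e.
by apply: le_trans; rewrite lee_fin euc_dist_ge0.
Qed.

Lemma curve_length_mono g a s t : s <= t ->
  (curve_length g a s <= curve_length g a t)%E.
Proof.
move=> st; apply: le_trans (curve_length_step g a st).
by rewrite leeDl// lee_fin euc_dist_ge0.
Qed.

Lemma curve_length_fin_num g a b t : a <= t -> t <= b ->
  (curve_length g a b < +oo)%E -> curve_length g a t \is a fin_num.
Proof.
move=> at_ tb gab; rewrite ge0_fin_numE; last exact: curve_length_ge0.
exact: le_lt_trans (curve_length_mono g a tb) gab.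
Qed.

Lemma eq_curve_length g g' a b : (forall t, a <= t <= b -> g t = g' t) ->
  curve_length g a b = curve_length g' a b.
Proof.
move=> gg'; rewrite /curve_length; congr ereal_sup; apply/seteqP.
have h l : itv_partition a b l -> polygon_length g a b l = polygon_length g' a b l.
  move=> abl; apply: eq_big_nat => i /andP[_ il].
  have il' := ltnW il.
  by rewrite !gg' ?(itv_partition_nth_ge _ abl) ?(itv_partition_nth_le _ abl).
by split => _ [l abl <-]; exists l => //; congr (_%:E);
  [exact: esym (h l abl)|exact: h l abl].
Qed.

(* For partitions of [a, t], the step which jumps over s is replaced by two steps
   through s. *)
Lemma curve_length_extend g a s t (V : R -> R) : a <= s -> s <= t ->
  curve_length g a s \is a fin_num ->
  (forall u v, s <= u -> u <= v -> v <= t -> E (g u) (g v) <= V v - V u) ->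
  (curve_length g a t <= curve_length g a s + (V t - V s)%:E)%E.
Proof.
move=> as_ st fs gV; set L := fine (curve_length g a s).
have LE : curve_length g a s = L%:E by rewrite /L fineK.
have before l r : itv_partition a r l -> r <= s ->
    polygon_length g a r l + E (g r) (g s) <= L.
  move=> arl rs; rewrite -lee_fin -LE EFinD.
  apply: le_trans (curve_length_step g a rs); rewrite leeD2r//.
  exact: polygon_length_le_curve_length.
suff after l r : itv_partition a r l -> s <= r -> r <= t ->
    polygon_length g a r l <= L + (V r - V s).
  by rewrite LE; apply: curve_length_le => l atl; rewrite -EFinD lee_fin after.
elim/last_ind: l r => [|l r' IH] r arl sr rt.
  have ar := itv_partition_nil arl.
  have rs : r = s by apply/eqP; rewrite eq_le sr andbT -ar.
  by rewrite /polygon_length big_nil rs subrr addr0 /L fine_ge0// curve_length_ge0.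
have {}arl : itv_partition a (last a l) l /\ last a l < r /\ r' = r.
  move: arl => [+ /eqP]; rewrite rcons_path last_rcons => /andP[al lr] rr'.
  by do ?split => //; rewrite -?rr'.
have [arl' [lr rr']] := arl; subst r'.
rewrite (polygon_length_rcons _ _ _ (last a l)).
have [sl|/ltW ls] := leP s (last a l).
  have := IH _ arl' sl (le_trans (ltW lr) rt).
  by have := gV _ _ sl (ltW lr) rt; lra.
have := before _ _ arl' ls; have := gV _ _ (lexx s) sr rt.
have := euc_dist_triangle (g (last a l)) (g s) (g r); lra.
Qed.

Lemma bounded_variation_coord g a b i : (curve_length g a b < +oo)%E -> a <= b ->
  bounded_variation a b (fun t => g t ord0 i).
Proof.
move=> gab ab; exists (fine (curve_length g a b)) => _ [l abl <-].
rewrite -lee_fin fineK; last exact: curve_length_fin_num gab.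
apply: le_trans (polygon_length_le_curve_length g b abl).
rewrite lee_fin; apply: ler_sum => j _; rewrite distrC.
exact: euc_dist_coord.
Qed.

(** The total variations of the coordinates are continuous, hence so is their sum [V]. Chords are
    dominated by increments of [V], and by [curve_length_extend] so are increments of the length. *)
Lemma curve_length_continuous g a b : a <= b -> {within `[a, b], continuous g} ->
  (curve_length g a b < +oo)%E ->
  {within `[a, b], continuous (fun t => fine (curve_length g a t))}.
Proof.
rewrite le_eqVlt => /predU1P[<- _ _|ab cg gab].
  by rewrite set_itv1; exact: continuous_subspace1.
pose G i t := g t ord0 i.
have bv i : bounded_variation a b (G i) := bounded_variation_coord i gab (ltW ab).
have cG i : {within `[a, b], continuous (G i)}.
  apply/subspace_continuousP => x abx; apply/cvgrPdist_lt => e e0.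
  have /cvg_euc_dist/(_ e e0) := (subspace_continuousP _ _).1 cg x abx.
  by apply: filterS => t; apply: le_lt_trans; exact: euc_dist_coord.
pose V t := \sum_i fine (total_variation a t (G i)).
have cV : {within `[a, b], continuous V}.
  apply/subspace_continuousP => x abx.
  suff h (l : seq 'I_n) : (fun t => \sum_(i <- l) fine (total_variation a t (G i)))
      @ within `[a, b] (nbhs x) --> \sum_(i <- l) fine (total_variation a x (G i)).
    exact: h.
  elim: l => [|i l IH].
    rewrite (_ : (fun t => _) = fun=> 0) ?big_nil; first exact: cvg_cst.
    by apply/funext => t; rewrite big_nil.
  rewrite big_cons (_ : (fun t => _) = (fun t => fine (total_variation a t (G i))) \+
    (fun t => \sum_(i <- l) fine (total_variation a t (G i)))); last first.
    by apply/funext => t; rewrite big_cons.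
  apply: cvgD IH.
  have /subspace_continuousP := total_variation_continuous ab (cG i) (bv i).
  exact.
have gV u v : a <= u -> u <= v -> v <= b -> E (g u) (g v) <= V v - V u.
  move=> au uv vb; apply: le_trans (euc_dist_le_sum _ _) _.
  rewrite /V -sumrB; apply: ler_sum => i _.
  have fin w : a <= w -> w <= b -> total_variation a w (G i) \is a fin_num.
    move=> aw wb; apply/bounded_variationP => //.
    exact: bounded_variationl wb (bv i).
  have fin' : total_variation u v (G i) \is a fin_num.
    apply/bounded_variationP => //.
    apply: (@bounded_variationr _ a) => //.
    by apply: (bounded_variationl _ vb (bv i)); exact: le_trans uv.
  rewrite (total_variationD _ au uv) fineD// ?fin ?(le_trans uv)//.
  rewrite addrAC subrr add0r distrC -lee_fin fineK//.
  exact: total_variation_ge.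
pose L t := fine (curve_length g a t).
have fL t : a <= t -> t <= b -> curve_length g a t \is a fin_num.
  by move=> at_ tb; exact: curve_length_fin_num gab.
have LV u v : a <= u -> u <= v -> v <= b -> `|L v - L u| <= `|V v - V u|.
  move=> au uv vb; have av := le_trans au uv; have ub := le_trans uv vb.
  rewrite [leLHS]ger0_norm; last first.
    rewrite subr_ge0 /L; apply: fine_le; rewrite ?fL//.
    exact: curve_length_mono.
  apply: le_trans (ler_norm _); rewrite /L lerBlDl -lee_fin EFinD !fineK ?fL//.
  apply: curve_length_extend => //; first exact: fL.
  move=> u' v' uu' u'v' v'v.
  by apply: gV => //; [exact: le_trans uu'|exact: le_trans vb].
apply/subspace_continuousP => x abx; apply/cvgrPdist_lt => e e0.
have /cvgrPdist_lt/(_ e e0) := (subspace_continuousP _ _).1 cV x abx.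
move: abx; rewrite /= in_itv/= => /andP[ax xb].
rewrite !near_withinE; apply: filterS => t tV abt.
apply: le_lt_trans (tV abt); move: abt; rewrite /= in_itv/= => /andP[at_ tb].
have [tx|/ltW xt] := leP t x; first exact: LV.
by rewrite distrC (distrC (V x)); exact: LV.
Qed.

Lemma euc_dist_le_curve_length g a b s t : (curve_length g a b < +oo)%E ->
  a <= s <= b -> a <= t <= b ->
  E (g s) (g t) <= `|fine (curve_length g a s) - fine (curve_length g a t)|.
Proof.
move=> gab; wlog st : s t / s <= t.
  move=> h sab tab; have [st|/ltW ts] := leP s t; first exact: h.
  by rewrite euc_distC distrC; exact: h.
move=> /andP[as_ sb] /andP[at_ tb].
have fs := curve_length_fin_num as_ sb gab.
have ft := curve_length_fin_num at_ tb gab.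
rewrite distrC; apply: le_trans (ler_norm _).
by rewrite lerBrDl -lee_fin EFinD !fineK//; exact: curve_length_step.
Qed.

(** [xget] may choose another parameter with the same length, but the chord between two such
    parameters is at most the difference of lengths, which is 0. *)
Lemma arclength_paramE g a b t : (curve_length g a b < +oo)%E -> a <= t <= b ->
  arclength_param g a b (fine (curve_length g a t)) = g t.
Proof.
move=> gab abt.
have ft : curve_length g a t \is a fin_num.
  by case/andP: abt => at_ tb; exact: curve_length_fin_num gab.
have := @xgetI _ a [set s | a <= s <= b /\
  curve_length g a s = (fine (curve_length g a t))%:E] t.
rewrite fineK// => /(_ (conj abt erefl)).
rewrite /arclength_param fineK//; set s := xget _ _ => -[abs gs].
apply: euc_dist_eq0; apply: le_trans (euc_dist_le_curve_length gab abs abt) _.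
by rewrite gs subrr normr0.
Qed.

Lemma curve_length_surj g a b u : a <= b -> {within `[a, b], continuous g} ->
  (curve_length g a b < +oo)%E -> 0 <= u <= fine (curve_length g a b) ->
  exists2 t, a <= t <= b & u = fine (curve_length g a t).
Proof.
move=> ab cg gab /andP[u0 uL].
have [|t] := @IVT _ _ _ _ u ab (curve_length_continuous ab cg gab).
  by rewrite curve_lengthxx/= ge_min u0 le_max uL orbT.
by rewrite in_itv/= => abt <-; exists t.
Qed.

End CurveLength.

(** * Integrals of continuous functions over segments *)

Section ContinuousIntegral.
Context {R : realType} (f : R -> R).
Context (fc : continuous f).

Local Notation I u v := (\int[lebesgue_measure]_(x in `[u, v]) f x).

Lemma continuous_itv_integrable (u v : R) :
  (@lebesgue_measure R).-integrable `[u, v] (EFin \o f).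
Proof.
apply: continuous_compact_integrable; first exact: segment_compact.
exact: continuous_subspaceT.
Qed.

Lemma continuous_integral_itvD (u v w : R) : u <= v -> v <= w ->
  I u w = I u v + I v w.
Proof.
move=> uv vw.
have := @Rintegral_itvB R f (BLeft u) (BRight w) v (continuous_itv_integrable u w).
rewrite !bnd_simp => /(_ uv vw) h; apply/eqP; rewrite addrC -subr_eq; apply/eqP.
rewrite h Rintegral_itv_obnd_cbnd//.
apply: (integrableS _ _ _ (continuous_itv_integrable v w)) => //.
exact: subset_itv_oc_cc.
Qed.

Lemma integral_itv_cst (u v m : R) : u <= v ->
  \int[@lebesgue_measure R]_(x in `[u, v]) m = m * (v - u).
Proof.
move=> uv; rewrite Rintegral_cst//= lebesgue_measure_itv/= lte_fin.
by case: ltP => //= vu; rewrite (_ : v = u) ?subrr//; apply/eqP; rewrite eq_le uv vu.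
Qed.

Lemma continuous_integral_ge (u v m : R) : u <= v ->
  (forall s, u <= s <= v -> m <= f s) -> m * (v - u) <= I u v.
Proof.
move=> uv mf; rewrite -integral_itv_cst//; apply: le_Rintegral => //.
- by apply: continuous_compact_integrable; [exact: segment_compact|
    apply: continuous_subspaceT => ?; exact: cvg_cst].
- exact: continuous_itv_integrable.
Qed.

Lemma continuous_integral_le (u v m : R) : u <= v ->
  (forall s, u <= s <= v -> f s <= m) -> I u v <= m * (v - u).
Proof.
move=> uv mf; rewrite -integral_itv_cst//; apply: le_Rintegral => //.
- exact: continuous_itv_integrable.
- by apply: continuous_compact_integrable; [exact: segment_compact|
    apply: continuous_subspaceT => ?; exact: cvg_cst].
Qed.

End ContinuousIntegral.

(** * Quasihyperbolic chains *)

Section BoundaryDistance.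
Context {R : realType} {n : nat} (Omega : set 'rV[R]_n).
Context (Oopen : open Omega) (Onontriv : Omega !=set0)
  (Oproper : Omega `<` setT).
Implicit Types x y z : 'rV[R]_n.

Local Notation E := euc_dist.
Local Notation rho := (boundary_dist Omega).

Definition segment x y (t : R) := x + t *: (y - x).

Lemma euc_dist_segment x y (s t : R) :
  E (segment x y s) (segment x y t) = `|s - t| * E x y.
Proof.
rewrite [RHS]mulrC -sqrtr_sqr -sqrtrM; last first.
  by apply: sumr_ge0 => i _; exact: sqr_ge0.
congr Num.sqrt; rewrite mulr_suml; apply: eq_bigr => i _.
by rewrite -exprMn /segment !mxE -[RHS]sqrrN; congr (_ ^+ 2); ring.
Qed.

Lemma segment0 x y : segment x y 0 = x.
Proof. by rewrite /segment scale0r addr0. Qed.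

Lemma segment1 x y : segment x y 1 = y.
Proof. by rewrite /segment scale1r subrKC. Qed.

(** Take the supremum of the parameters at which the segment is in [Omega]: points of [Omega]
    accumulate there, and if it were interior, a slightly larger parameter would still be in the
    set. *)
Lemma segment_boundary x y : Omega x -> ~ Omega y ->
  exists2 z, euc_boundary Omega z & E x z <= E x y.
Proof.
move=> Ox nOy; set f := segment x y.
have fE s t : E (f s) (f t) = `|s - t| * E x y := euc_dist_segment x y s t.
pose S : set R := [set t | 0 <= t <= 1 /\ Omega (f t)].
have S0 : S 0 by rewrite /S/= lexx ler01 /f segment0.
have hS : has_sup S by split; [exists 0|exists 1 => t [/andP[]]].
pose s := sup S.
have s0 : 0 <= s by exact: (ub_le_sup hS.2).
have s1 : s <= 1 by apply: ge_sup; [exists 0|move=> t [/andP[]]].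
exists (f s); last first.
  rewrite -{1}(segment0 x y) -/f fE sub0r normrN ger0_norm//.
  by rewrite -[leRHS]mul1r ler_wpM2r// euc_dist_ge0.
(* [E x y + 1] is a Lipschitz constant of [f] by which one can divide, even if [E x y] vanishes. *)
have Exy : 0 < E x y + 1 by rewrite ltr_wpDl// euc_dist_ge0.
split.
  move=> A /nbhs_euc_dist[e e0 eA].
  have [|t St ts] := @sup_adherent _ S (e / (E x y + 1)) _ hS; first exact: divr_gt0.
  exists (f t); split; first exact: St.2.
  apply: eA; rewrite fE ger0_norm ?subr_ge0; last exact: (ub_le_sup hS.2).
  have : s - t < e / (E x y + 1) by move: ts; rewrite -/s; lra.
  rewrite ltr_pdivlMr// => /(le_lt_trans _); apply.
  by rewrite ler_wpM2l ?lerDl// subr_ge0; exact: (ub_le_sup hS.2).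
move=> /interior_subset Os.
have s1' : s < 1.
  rewrite lt_neqAle s1 andbT; apply/eqP => s1'; apply: nOy.
  by rewrite -(segment1 x y) -s1'.
have /nbhs_euc_dist[e e0 eO] : nbhs (f s) Omega by exact: open_nbhs_nbhs.
pose h := Num.min (1 - s) (e / (E x y + 1) / 2).
have h0 : 0 < h by rewrite lt_min subr_gt0 s1' !divr_gt0.
have : S (s + h).
  split.
    by rewrite addr_ge0 ?(ltW h0)//= -lerBrDl ge_min lexx.
  apply: eO; rewrite fE opprD addNKr normrN gtr0_norm//.
  have he : h < e / (E x y + 1).
    apply: le_lt_trans (_ : _ <= e / (E x y + 1) / 2) _.
      by rewrite ge_min lexx orbT.
    by rewrite ltr_pdivrMr// ltr_pMr ?divr_gt0// ltr1n.
  move: he; rewrite ltr_pdivlMr// => /(le_lt_trans _); apply.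
  by rewrite ler_wpM2l ?lerDl// ltW.
by move=> /(ub_le_sup hS.2); rewrite -/s; lra.
Qed.

Lemma euc_boundary_nonempty : exists z, euc_boundary Omega z.
Proof.
have [x Ox] := Onontriv; have [_ /existsNP[y nOy]] := Oproper.
have [|z ? _] := @segment_boundary x y Ox; last by exists z.
by move=> Oy; apply: nOy.
Qed.

Lemma boundary_dist_le x y : euc_boundary Omega y -> rho x <= E x y.
Proof.
move=> By; apply: ge_inf; last by exists y.
by exists 0 => _ [z _ <-]; exact: euc_dist_ge0.
Qed.

Lemma le_boundary_dist x (a : R) :
  (forall y, euc_boundary Omega y -> a <= E x y) -> a <= rho x.
Proof.
move=> ax; apply: lb_le_inf.
  by have [z Bz] := euc_boundary_nonempty; exists (E x z), z.
by move=> _ [z Bz <-]; exact: ax.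
Qed.

Lemma boundary_dist_lipschitz x y : rho x <= rho y + E x y.
Proof.
rewrite -lerBlDr; apply: le_boundary_dist => z Bz.
rewrite lerBlDr addrC; apply: le_trans (euc_dist_triangle x y z).
exact: boundary_dist_le.
Qed.

Lemma boundary_dist_gt0 x : Omega x -> 0 < rho x.
Proof.
move=> Ox; have /nbhs_euc_dist[e e0 eO] : nbhs x Omega by exact: open_nbhs_nbhs.
apply: lt_le_trans e0 _; apply: le_boundary_dist => y [_ nOy].
rewrite leNgt; apply/negP => /eO Oy; apply: nOy.
by rewrite (interior_id _).1.
Qed.

Lemma boundary_dist_inside x y : Omega x -> E x y < rho x -> Omega y.
Proof.
move=> Ox xy; apply: contrapT => /(segment_boundary Ox)[z Bz xz].
by have := boundary_dist_le x Bz; lra.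
Qed.

Lemma boundary_dist_closure x : closure Omega x -> 0 < rho x -> Omega x.
Proof.
move=> cx x0; apply: contrapT => nOx.
have Bx : euc_boundary Omega x.
  by split => //; rewrite (interior_id _).1.
by have := boundary_dist_le x Bx; rewrite euc_distxx leNgt x0.
Qed.

(* The ball of radius E x y around x or y is at distance at least m from the
   boundary, so that w bounds the quasihyperbolic length of the segment. The
   condition is symmetric in x and y. *)
Definition qh_step x y (w : R) := exists m : R,
  [/\ 0 < m, m + E x y <= rho x, m + E x y <= rho y & E x y <= w * m].

(** The bound [e] on each single weight is what makes the chain an approximate geodesic up to [e] in
    [qh_chain_curve]. *)
Inductive qh_chain (e : R) (x : 'rV[R]_n) : 'rV[R]_n -> R -> Prop :=
| qh_chain0 : qh_chain e x x 0
| qh_chainS y z w l : qh_chain e x y l -> qh_step y z w -> w <= e ->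
    qh_chain e x z (l + w).

Lemma qh_stepC x y w : qh_step x y w -> qh_step y x w.
Proof. by move=> [m [m0 mx my mw]]; exists m; rewrite euc_distC; split. Qed.

Lemma qh_step_ge0 x y w : qh_step x y w -> 0 <= w.
Proof.
move=> [m [m0 mx my mw]]; have := le_trans (euc_dist_ge0 x y) mw.
by rewrite pmulr_lge0.
Qed.

Lemma qh_step_inside x y w : qh_step x y w -> Omega x -> Omega y.
Proof.
move=> [m [m0 mx my mw]] Ox; apply: (boundary_dist_inside Ox).
by apply: lt_le_trans mx; rewrite ltrDr.
Qed.

Lemma qh_step_near x y : Omega x -> E x y <= rho x / 4 ->
  qh_step x y (2 * E x y / rho x).
Proof.
move=> Ox xy; have x0 := boundary_dist_gt0 Ox.
have := boundary_dist_lipschitz x y => lip.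
exists (rho x / 2); split; [lra|lra|lra|].
by rewrite mulrA divfK ?gt_eqF// mulrC mulrA mulVf// mul1r.
Qed.

Lemma qh_chain_cat e x y z l l' :
  qh_chain e x y l -> qh_chain e y z l' -> qh_chain e x z (l + l').
Proof.
move=> xy yz; elim: yz => {z l'} [|z z' w l' _ IH zz' we]; first by rewrite addr0.
by rewrite addrA; exact: qh_chainS zz' we.
Qed.

Lemma qh_chain_cons e x y z w l : qh_step x y w -> w <= e ->
  qh_chain e y z l -> qh_chain e x z (w + l).
Proof.
move=> xy we; apply: qh_chain_cat; rewrite -[w]add0r.
exact: qh_chainS (qh_chain0 _ _) xy we.
Qed.

Lemma qh_chainC e x y l : qh_chain e x y l -> qh_chain e y x l.
Proof.
elim=> {y l} [|y z w l _ IH yz we]; first exact: qh_chain0.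
by rewrite addrC; apply: qh_chain_cons IH => //; exact: qh_stepC.
Qed.

Lemma qh_chain_ge0 e x y l : qh_chain e x y l -> 0 <= l.
Proof. by elim=> // {}y z w {}l _ l0 /qh_step_ge0 w0 _; exact: addr_ge0. Qed.

Lemma qh_chain_inside e x y l : qh_chain e x y l -> Omega x -> Omega y.
Proof.
by move=> xy Ox; elim: xy => // {}y z w {}l _ Oy /qh_step_inside yz _; exact: yz.
Qed.

(** For one step, rho y <= rho z + w m <= (1 + w) rho z <= e^w rho z. This is the classical
    comparison of the logarithm of the boundary distance with the quasihyperbolic metric. *)
Lemma qh_chain_boundary_dist e x y l : Omega x ->
  qh_chain e x y l -> rho x <= expR l * rho y.
Proof.
move=> Ox; elim=> [|{}y z w {}l xy IH yz _]; first by rewrite expR0 mul1r.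
have Oy := qh_chain_inside xy Ox.
have w0 := qh_step_ge0 yz.
apply: le_trans IH _; rewrite expRD -mulrA ler_pM2l ?expR_gt0//.
have Oz := boundary_dist_gt0 (qh_step_inside yz Oy).
have [m [m0 mx my mw]] := yz.
have := boundary_dist_lipschitz y z; have := expR_ge1Dx w.
have := euc_dist_ge0 y z; nra.
Qed.

(** While the weight is at most 1/2, the chain stays within [rho x] of [x], where the boundary
    distance is at most [2 * rho x]; a step of weight [w] then moves by at most [2 * w * rho x]. The
    separation axiom of the metric rests on this. *)
Lemma qh_chain_dist e x y l : Omega x -> qh_chain e x y l -> l <= 1 / 2 ->
  E x y <= 2 * l * rho x.
Proof.
move=> Ox; elim=> [|{}y z w {}l xy IH yz _] l2.
  by rewrite euc_distxx mulr0 mul0r.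
have w0 := qh_step_ge0 yz; have l0 := qh_chain_ge0 xy.
have x0 := boundary_dist_gt0 Ox.
have Exy : E x y <= 2 * l * rho x by apply: IH; lra.
have [m [m0 my _ mw]] := yz.
have := boundary_dist_lipschitz y x; rewrite euc_distC.
have := euc_dist_triangle x y z; have := euc_dist_ge0 y z.
have : w * m <= w * (2 * rho x).
  rewrite ler_wpM2l//.
  have := boundary_dist_lipschitz y x; rewrite euc_distC.
  have := euc_dist_ge0 y z; nra.
nra.
Qed.

(** The points reachable from [x] form an open and relatively closed subset of [Omega], since points
    near [z] are one step away from [z]. Through [rectifiable_of_qh_chain] this makes the set of
    lengths in [qh_metric] nonempty, so that its infimum is meaningful. *)
Lemma qh_chain_connected x y : connected Omega -> Omega x -> Omega y ->
  exists l, qh_chain 1 x y l.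
Proof.
move=> Ocon Ox Oy.
pose B := [set z | Omega z /\ exists l, qh_chain 1 x z l].
have near_in z z' : Omega z -> E z z' < rho z / 4 ->
    Omega z' /\ qh_chain 1 z z' (2 * E z z' / rho z).
  move=> Oz zz'; have z0 := boundary_dist_gt0 Oz.
  have st := qh_step_near Oz (ltW zz'); split; first exact: qh_step_inside st Oz.
  rewrite -[X in qh_chain _ _ _ X]addr0; apply: qh_chain_cons (qh_chain0 _ _) => //.
  by rewrite ler_pdivrMr// mul1r; lra.
have Bo : open B.
  rewrite openE => z [Oz [l xz]]; apply/nbhs_euc_dist; exists (rho z / 4).
    by have := boundary_dist_gt0 Oz; lra.
  move=> z' /(near_in _ _ Oz)[Oz' zz']; split => //.
  by exists (l + 2 * E z z' / rho z); exact: qh_chain_cat zz'.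
suff OB : B = Omega by move: Oy; rewrite -OB => -[].
apply: Ocon.
- by exists x; split => //; exists 0; exact: qh_chain0.
- by exists B => //; rewrite setIidr// => z [].
- exists (closure B); first exact: closed_closure.
  rewrite eqEsubset; split => z.
    by move=> [Oz Bz]; split; [|apply: subset_closure].
  move=> [Oz cBz]; split => //.
  have : nbhs z [set z' | E z z' < rho z / 4].
    apply/nbhs_euc_dist; exists (rho z / 4) => //.
    by have := boundary_dist_gt0 Oz; lra.
  move=> /cBz[z' [[Oz' [l xz']] /(near_in _ _ Oz)[_ zz']]].
  by exists (l + 2 * E z z' / rho z); apply: (qh_chain_cat xz'); exact: qh_chainC.
Qed.

Lemma boundary_dist_ge0 x : 0 <= rho x.
Proof. by apply: le_boundary_dist => y _; exact: euc_dist_ge0. Qed.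

Definition qh_density z := (rho z)^-1.

(** Precomposition with the clamp extends a continuous function on [0, S] to the whole line, so the
    integral lemmas need no subspace topology. *)
Definition clamp (S s : R) := Num.max 0 (Num.min s S).

Lemma clampE (S s : R) : 0 <= s <= S -> clamp S s = s.
Proof.
by move=> /andP[s0 sS]; rewrite /clamp min_l// max_r.
Qed.

Lemma clamp_itv (S s : R) : 0 <= S -> 0 <= clamp S s <= S.
Proof.
by move=> S0; rewrite /clamp le_max lexx ge_max S0 ge_min lexx orbT.
Qed.

Lemma clamp_lipschitz (S s t : R) : `|clamp S s - clamp S t| <= `|s - t|.
Proof.
wlog st : s t / s <= t.
  move=> h; have [/h//|/ltW/h] := leP s t.
  by rewrite distrC (distrC t).
rewrite distrC (distrC s) [leRHS]ger0_norm ?subr_ge0//.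
rewrite /clamp; case: (leP t S) => tS; case: (leP s S) => sS;
  rewrite /Num.max; do ![case: ifPn; rewrite -?leNgt => ?];
  rewrite ler_norml; apply/andP; split; lra.
Qed.

(** * From curves to chains *)

Section UnitSpeed.
Context (S : R) (H : R -> 'rV[R]_n).
Context (S0 : 0 <= S)
  (Hlip : forall s t, 0 <= s <= S -> 0 <= t <= S -> E (H s) (H t) <= `|s - t|)
  (HO : forall s, 0 <= s <= S -> Omega (H s)).

Let f s := qh_density (H (clamp S s)).

Let rhoH_continuous : continuous (fun s => rho (H (clamp S s))).
Proof.
move=> s; apply/cvgrPdist_lt => e e0; near=> t.
have cs := clamp_itv s S0; have ct := clamp_itv t S0.
apply: le_lt_trans (_ : _ <= `|s - t|) _; last first.
  by near: t; exact: (nbhsx_ballx s e e0).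
apply: le_trans (clamp_lipschitz S s t); apply: le_trans (Hlip cs ct).
rewrite ler_norml; apply/andP; split.
  have := boundary_dist_lipschitz (H (clamp S t)) (H (clamp S s)).
  by rewrite euc_distC; lra.
have := boundary_dist_lipschitz (H (clamp S s)) (H (clamp S t)); lra.
Unshelve. all: by end_near. Qed.

Lemma qh_density_continuous : continuous f.
Proof.
move=> s; apply: (@cvgV R _ _ _ (fun s => rho (H (clamp S s))));
  last exact: rhoH_continuous.
by rewrite gt_eqF// boundary_dist_gt0//; apply: HO; exact: clamp_itv.
Qed.

Lemma qh_density_integral :
  \int[lebesgue_measure]_(s in `[0, S]) qh_density (H s) =
  \int[lebesgue_measure]_(s in `[0, S]) f s.
Proof.
by apply: eq_Rintegral => s; rewrite inE/= in_itv/= => sS; rewrite /f clampE.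
Qed.

Lemma qh_chain_of_curve (e : R) : 0 < e -> exists2 l,
  l < \int[lebesgue_measure]_(s in `[0, S]) qh_density (H s) + e &
  qh_chain e (H 0) (H S) l.
Proof.
move=> e0; rewrite qh_density_integral.
have [c _ cmin] := @EVT_min R (fun s => rho (H (clamp S s))) 0 S S0
  (continuous_subspaceT rhoH_continuous).
pose eta := rho (H (clamp S c)).
have eta0 : 0 < eta by apply: boundary_dist_gt0; apply: HO; exact: clamp_itv.
have etaH s : 0 <= s <= S -> eta <= rho (H s).
  by move=> sS; rewrite -(clampE sS); apply: cmin; rewrite in_itv.
pose B := S / eta.
have B0 : 0 <= B by rewrite divr_ge0// ltW.
(* The three summands give in turn [4 * h <= eta]; [3 * kap <= e], which bounds each weight
   [kap + c0]; and a total error [N * c0 = 6 * B * kap] below [e]. *)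
pose N := (Num.truncn (4 * B + 3 * B / e + 12 * B * (B + 1) / e)).+1.
have N0 : 0 < N%:R :> R by rewrite ltr0n.
have [NB1 NB2 NB3] : [/\ 4 * B <= N%:R, 3 * B <= N%:R * e &
    12 * B * (B + 1) <= N%:R * e].
  have b1 : 0 <= 4 * B by rewrite mulr_ge0.
  have b2 : 0 <= 3 * B / e by rewrite divr_ge0 ?(ltW e0)// mulr_ge0.
  have b3 : 0 <= 12 * B * (B + 1) / e.
    by rewrite divr_ge0 ?(ltW e0)// mulr_ge0 ?addr_ge0// mulr_ge0.
  have := truncn_itv (addr_ge0 (addr_ge0 b1 b2) b3) => /andP[_].
  rewrite -/N => hN.
  have b2' : 3 * B / e <= N%:R by lra.
  have b3' : 12 * B * (B + 1) / e <= N%:R by lra.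
  by split; [lra|rewrite -ler_pdivrMr|rewrite -ler_pdivrMr].
pose h := S / N%:R.
have h0 : 0 <= h by rewrite divr_ge0// ltW.
have hN : h * N%:R = S by rewrite /h divfK// gt_eqF.
have h4 : 4 * h <= eta.
  move: NB1; rewrite /B mulrA ler_pdivrMr// => NB1.
  by rewrite /h mulrA ler_pdivrMr// (mulrC eta).
pose kap := h / eta.
have kap0 : 0 <= kap by rewrite divr_ge0// ltW.
have hk : h = kap * eta by rewrite /kap divfK// gt_eqF.
have kB : kap * N%:R = B by rewrite /kap mulrAC hN.
(* I u v + c0 is a weight for the step from H u to H v, and N c0 = O(1 / N). *)
pose c0 := 6 * kap ^+ 2.
pose I u v := \int[lebesgue_measure]_(s in `[u, v]) f s.
have node i : (i <= N)%N -> 0 <= i%:R * h <= S.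
  move=> iN; rewrite mulr_ge0//= -hN mulrC ler_wpM2l// ler_nat//.
have step i : (i < N)%N ->
    qh_step (H (i%:R * h)) (H (i.+1%:R * h)) (I (i%:R * h) (i.+1%:R * h) + c0) /\
    I (i%:R * h) (i.+1%:R * h) + c0 <= e.
  move=> iN; have n1 := node i (ltnW iN); have n2 := node i.+1 iN.
  set u := i%:R * h in n1 *; set v := i.+1%:R * h in n2 *.
  have uv : v = u + h by rewrite /u /v -natr1 mulrDl mul1r.
  have Hd s : u <= s <= v -> E (H u) (H s) <= h.
    move=> /andP[us sv]; apply: le_trans (Hlip n1 _) _.
      case/andP: n1 => u0 _; case/andP: n2 => _ vS.
      by rewrite (le_trans u0)// (le_trans sv).
    by rewrite distrC ger0_norm ?subr_ge0// lerBlDl -uv.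
  have uv' : u <= v by rewrite uv lerDl.
  have sS s : u <= s <= v -> 0 <= s <= S.
    by move=> /andP[us sv]; case/andP: n1 => u0 _; case/andP: n2 => _ vS;
      rewrite (le_trans u0)// (le_trans sv).
  have Ige : (rho (H u) + h)^-1 * h <= I u v.
    rewrite -[X in _ * X](_ : v - u = h); last by rewrite uv addrAC subrr add0r.
    apply: (continuous_integral_ge qh_density_continuous) => // s us.
    rewrite /f clampE ?sS// lef_pV2 ?posrE.
    - have := boundary_dist_lipschitz (H s) (H u); rewrite euc_distC.
      by have := Hd s us; lra.
    - by rewrite ?posrE; have := etaH u n1; lra.
    - by rewrite ?posrE; apply: boundary_dist_gt0; exact/HO/sS.
  have Ile : I u v <= eta^-1 * h.
    rewrite -[X in _ * X](_ : v - u = h); last by rewrite uv addrAC subrr add0r.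
    apply: (continuous_integral_le qh_density_continuous) => // s us.
    rewrite /f clampE ?sS// lef_pV2 ?posrE//; first exact/etaH/sS.
    by rewrite ?posrE; apply: boundary_dist_gt0; exact/HO/sS.
  rewrite mulrC -/kap in Ile.
  have r0 := etaH u n1.
  have k4 : kap <= 1 / 4 by rewrite /kap ler_pdivrMr//; lra.
  split; last first.
    have : kap * 3 <= e.
      by rewrite -(ler_pM2r N0) mulrAC kB (mulrC B) (mulrC e).
    rewrite /c0; nra.
  have d := Hd v; rewrite lexx uv' in d; have {}d := d isT.
  (* Replacing rho + h by this m in I (rho + h) >= h loses 3 h I <= 3 h kap. Since m >= eta / 2, the
     term c0 m is at least 3 kap^2 eta = 3 h kap and makes up for it; hence the factor 6 in [c0]. *)
  exists (rho (H u) - 2 * h); split; [lra|lra| |].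
    by have := boundary_dist_lipschitz (H u) (H v); lra.
  apply: le_trans d _.
  have {}Ige : h <= I u v * (rho (H u) + h).
    rewrite mulrC -ler_pdivrMl//; lra.
  have : 3 * h * I u v <= 3 * h * kap by rewrite ler_wpM2l// mulr_ge0.
  have : c0 * (eta / 2) <= c0 * (rho (H u) - 2 * h).
    rewrite ler_wpM2l//; last lra.
    by rewrite /c0 mulr_ge0// sqr_ge0.
  have -> : c0 * (eta / 2) = 3 * h * kap by rewrite /c0 hk; field.
  move: (I u v) Ige => J; nra.
have chain i : (i <= N)%N ->
    qh_chain e (H 0) (H (i%:R * h)) (I 0 (i%:R * h) + i%:R * c0).
  elim: i => [|i IH] iN.
    rewrite !mul0r addr0 /I set_itv1 Rintegral_set1; exact: qh_chain0.
  have [st we] := step i iN.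
  have /andP[i0 _] := node i (ltnW iN).
  have ii : i%:R * h <= i.+1%:R * h by rewrite ler_wpM2r// ler_nat.
  rewrite /I (continuous_integral_itvD qh_density_continuous i0 ii).
  rewrite -natr1 [(_ + 1) * c0]mulrDl mul1r addrACA natr1.
  exact: qh_chainS (IH (ltnW iN)) st we.
exists (I 0 S + N%:R * c0).
  rewrite ltrD2l /c0 expr2 mulrCA (mulrC N%:R) -(mulrA kap) kB mulrCA.
  have kap6 : kap * (12 * (B + 1)) <= e.
    by rewrite -(ler_pM2r N0) mulrAC kB mulrCA mulrA (mulrC e).
  nra.
by have := chain N (leqnn N); rewrite (mulrC _ h) hN.
Qed.

End UnitSpeed.

Lemma arclength_param_unit_speed x y g (a b : R) :
  rectifiable_curve Omega x y g a b ->
  let S := fine (curve_length g a b) in let H := arclength_param g a b in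
  [/\ 0 <= S,
      forall s t, 0 <= s <= S -> 0 <= t <= S -> E (H s) (H t) <= `|s - t|,
      forall s, 0 <= s <= S -> Omega (H s), H 0 = x & H S = y].
Proof.
move=> [ab cg gO [ga gb] gab] S H.
have aab : a <= a <= b by rewrite lexx.
have bab : a <= b <= b by rewrite lexx andbT.
split.
- by rewrite /S fine_ge0// curve_length_ge0.
- move=> s t /(curve_length_surj ab cg gab)[s' s'ab ->].
  move=> /(curve_length_surj ab cg gab)[t' t'ab ->].
  rewrite /H !arclength_paramE//.
  exact: euc_dist_le_curve_length gab s'ab t'ab.
- move=> s /(curve_length_surj ab cg gab)[s' s'ab ->].
  by rewrite /H arclength_paramE//; exact: gO.
- have := arclength_paramE gab aab; rewrite curve_lengthxx/= ga; exact.
- by rewrite /H /S arclength_paramE.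
Qed.

(** * From chains to curves *)

Lemma clamp_continuous (S : R) : continuous (clamp S).
Proof.
move=> s; apply/cvgrPdist_lt => e e0; near=> t.
apply: le_lt_trans (clamp_lipschitz S s t) _.
by near: t; exact: (nbhsx_ballx s e e0).
Unshelve. all: by end_near. Qed.

(** When [g] is constantly [y] from [b] on, this attaches the segment from [y] to [z] on [b, b + 1];
    being one formula, it is continuous on the whole line without any gluing. *)
Definition extend_curve (g : R -> 'rV[R]_n) (b : R) y z (t : R) :=
  g t + clamp 1 (t - b) *: (z - y).

Section ExtendCurve.
Context (g : R -> 'rV[R]_n) (b : R) (y z : 'rV[R]_n).
Context (b0 : 0 <= b) (gy : forall t, b <= t -> g t = y).

Local Notation g' := (extend_curve g b y z).

Lemma extend_curve_before t : t <= b -> g' t = g t.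
Proof.
move=> tb; rewrite /extend_curve /clamp min_l; last lra.
by rewrite max_l ?scale0r ?addr0//; lra.
Qed.

Lemma extend_curve_after t : b <= t -> g' t = segment y z (clamp 1 (t - b)).
Proof. by move=> bt; rewrite /extend_curve gy. Qed.

Lemma extend_curve_end t : b + 1 <= t -> g' t = z.
Proof.
move=> bt; rewrite extend_curve_after; last lra.
rewrite /clamp min_r; last lra.
by rewrite max_r// segment1.
Qed.

Lemma extend_curve_continuous : continuous g -> continuous g'.
Proof.
move=> gc t; apply: cvgD; first exact: gc.
apply: cvgZr_tmp.
apply: (@continuous_comp _ _ _ (fun t => t - b) (clamp 1)).
  by apply: cvgB; [exact: cvg_id|exact: cvg_cst].
exact: clamp_continuous.
Qed.

Lemma extend_curve_dist u v : b <= u -> b <= v ->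
  E (g' u) (g' v) <= `|u - v| * E y z.
Proof.
move=> bu bv; rewrite !extend_curve_after// euc_dist_segment.
rewrite ler_wpM2r ?euc_dist_ge0//.
apply: le_trans (clamp_lipschitz _ _ _) _.
by rewrite opprB addrA subrK.
Qed.

Lemma extend_curve_near t : b <= t -> E y (g' t) <= E y z.
Proof.
move=> bt; rewrite extend_curve_after// -{1}(segment0 y z) euc_dist_segment.
rewrite -[leRHS]mul1r ler_wpM2r ?euc_dist_ge0// sub0r normrN.
by have /andP[c0 c1] := clamp_itv (t - b) (@ler01 R); rewrite ger0_norm.
Qed.

End ExtendCurve.

(** Each step attaches a segment. The arclength parametrizations of the old and new curves agree up
    to the old length; the rest is no longer than [E y z] and has boundary distance at least [m], so
    the integral grows by at most E y z / m <= w. *)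
Lemma curve_of_qh_chain e x y l : Omega x -> qh_chain e x y l ->
  exists (g : R -> 'rV[R]_n) (b : R),
    [/\ 0 <= b, continuous g, g 0 = x & forall t, b <= t -> g t = y] /\
    [/\ forall t, 0 <= t -> Omega (g t), (curve_length g 0 b < +oo)%E &
      line_integral qh_density g 0 b <= l].
Proof.
move=> Ox; elim=> {y l} [|y z w l xy [g [b [[b0 gc g0 gy] [gO gL gl]]]] yz we].
  exists (fun=> x), 0; do ?split => //.
  - by move=> t; exact: cvg_cst.
  - by rewrite curve_lengthxx ltry.
  by rewrite /line_integral curve_lengthxx/= set_itv1 Rintegral_set1.
have Oy := qh_chain_inside xy Ox.
have Oz := qh_step_inside yz Oy.
have [m [m0 my mz mw]] := yz.
pose g' := extend_curve g b y z; exists g', (b + 1).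
have g'g t : t <= b -> g' t = g t by exact: extend_curve_before.
have g'z t : b + 1 <= t -> g' t = z by exact: extend_curve_end.
have g'y : g' b = y by rewrite g'g// gy.
have g'c : continuous g' by exact: extend_curve_continuous.
have g'near t : b <= t -> E y (g' t) <= E y z by exact: extend_curve_near.
have g'O t : 0 <= t -> Omega (g' t).
  move=> t0; have [tb|/ltW bt] := leP t b; first by rewrite g'g//; exact: gO.
  by apply: (boundary_dist_inside Oy); have := g'near t bt; lra.
have bb1 : b <= b + 1 by rewrite lerDl.
have b10 : 0 <= b + 1 by exact: le_trans bb1.
have Lg'g t : t <= b -> curve_length g' 0 t = curve_length g 0 t.
  move=> tb; apply: eq_curve_length => s /andP[_ st]; apply: g'g.
  exact: le_trans tb.
have fb : curve_length g' 0 b \is a fin_num.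
  by rewrite Lg'g//; exact: curve_length_fin_num gL.
have g'ext := @curve_length_extend _ _ g' 0 b (b + 1) (fun t => t * E y z) b0 bb1 fb.
have {}g'ext : (curve_length g' 0 (b + 1) <= curve_length g' 0 b + (E y z)%:E)%E.
  have -> : E y z = (b + 1) * E y z - b * E y z by ring.
  apply: g'ext => u v bu uv _; apply: le_trans (extend_curve_dist _ gy bu _) _.
    exact: le_trans uv.
  by rewrite distrC ger0_norm ?subr_ge0// mulrBl.
have g'L : (curve_length g' 0 (b + 1) < +oo)%E.
  by apply: le_lt_trans g'ext _; rewrite -(fineK fb) -EFinD ltry.
do ?split => //; first by rewrite g'g// g0.
have rec : rectifiable_curve Omega x z g' 0 (b + 1).
  split => //; first exact: continuous_subspaceT.
  - by move=> t /andP[t0 _]; exact: g'O.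
  - by split; [rewrite g'g//|exact: g'z].
have [S'0 H'lip H'O H'0 H'S] := arclength_param_unit_speed rec.
have cw : {within `[0, b], continuous g} by exact: continuous_subspaceT.
have cw' : {within `[0, b + 1], continuous g'} by exact: continuous_subspaceT.
set S' := fine (curve_length g' 0 (b + 1)) in S'0 H'lip H'O H'S.
set H' := arclength_param g' 0 (b + 1) in H'lip H'O H'0 H'S.
pose S := fine (curve_length g 0 b).
have S0 : 0 <= S by rewrite fine_ge0// curve_length_ge0.
have fS : (S%:E = curve_length g' 0 b)%E by rewrite /S -Lg'g// fineK.
have fS' : (S'%:E = curve_length g' 0 (b + 1))%E.
  rewrite /S' fineK//; exact: curve_length_fin_num b10 (lexx _) g'L.
have SS' : S <= S' by rewrite -lee_fin fS fS'; exact: curve_length_mono.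
have S'E : S' - S <= E y z.
  by rewrite lerBlDl -lee_fin EFinD fS fS'.
have bb : 0 <= b <= b + 1 by rewrite b0.
have H'Sy : H' S = y.
  rewrite -g'y -(arclength_paramE g'L bb); congr (H' _).
  by rewrite -fS.
rewrite /line_integral -/S' -/H' qh_density_integral//.
have fc := qh_density_continuous S'0 H'lip H'O.
rewrite (continuous_integral_itvD fc S0 SS') lerD//.
  apply: le_trans gl; rewrite le_eqVlt; apply/orP; left; apply/eqP.
  apply: eq_Rintegral => s; rewrite inE/= in_itv/= => /andP[s0 sS].
  rewrite clampE ?s0 ?(le_trans sS)//.
  have sS0 : 0 <= s <= fine (curve_length g 0 b) by rewrite s0.
  have [t /andP[t0 tb] st] := curve_length_surj b0 cw gL sS0.
  have t0b : 0 <= t <= b by rewrite t0.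
  have t0b1 : 0 <= t <= b + 1 by rewrite t0 (le_trans tb).
  congr qh_density.
  rewrite [in RHS]st (arclength_paramE gL t0b) -(g'g t tb).
  by rewrite -(arclength_paramE g'L t0b1) Lg'g// st.
apply: (@le_trans _ _ (m^-1 * (S' - S))); last first.
  by rewrite ler_pdivrMl// mulrC; exact: le_trans S'E mw.
apply: (continuous_integral_le fc) => // s /andP[Ss sS'].
rewrite clampE ?sS' ?(le_trans S0)// lef_pV2 ?posrE//; last first.
  by rewrite ?posrE boundary_dist_gt0//; apply: H'O; rewrite sS' (le_trans S0).
have near : E y (H' s) <= E y z.
  have sS0 : 0 <= s <= fine (curve_length g' 0 (b + 1)) by rewrite (le_trans S0).
  have [t t01 st] := curve_length_surj b10 cw' g'L sS0.
  case/andP: (t01) => t0 tb.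
  have [bt|tb'] := leP b t.
    by rewrite st /H' arclength_paramE//; exact: g'near.
  (* A parameter before [b] has length at most [S], so this case leaves only the junction point
     [y]. *)
  suff -> : s = S by rewrite H'Sy euc_distxx euc_dist_ge0.
  apply/eqP; rewrite eq_le Ss andbT st.
  rewrite /S -(Lg'g b (lexx b)); apply: fine_le => //; last exact/curve_length_mono/ltW.
  exact: curve_length_fin_num t0 tb g'L.
by have := boundary_dist_lipschitz y (H' s); lra.
Qed.

Lemma qh_lengths_ge0 x y : lbound [set l | exists g a b,
  rectifiable_curve Omega x y g a b /\
  l = line_integral (fun z => (boundary_dist Omega z)^-1) g a b] 0.
Proof.
move=> _ [g [a [b [_ ->]]]]; apply: Rintegral_ge0 => s _.
by rewrite invr_ge0 boundary_dist_ge0.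
Qed.

Lemma qh_valP (x : Omega) : Omega (\val x).
Proof. by have := valP x; rewrite inE. Qed.

Lemma rectifiable_of_qh_chain e x y l : Omega x -> qh_chain e x y l ->
  exists (g : R -> 'rV[R]_n) (a b : R), rectifiable_curve Omega x y g a b /\
    line_integral qh_density g a b <= l.
Proof.
move=> Ox /(curve_of_qh_chain Ox)[g [b [[b0 gc g0 gb] [gO gL gl]]]].
exists g, 0, b; split => //; split => //.
- exact: continuous_subspaceT.
- by move=> t /andP[t0 _]; exact: gO.
- by split => //; exact: gb.
Qed.

Lemma qh_le_chain e l (x y : Omega) :
  qh_chain e (\val x) (\val y) l -> qh_metric Omega x y <= l.
Proof.
move=> /(rectifiable_of_qh_chain (qh_valP x))[g [a [b [gr gl]]]].
apply: le_trans gl; apply: ge_inf; first by exists 0; exact: qh_lengths_ge0.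
by exists g, a, b.
Qed.

Lemma qh_chain_le (e e' : R) x y l :
  e <= e' -> qh_chain e x y l -> qh_chain e' x y l.
Proof.
move=> ee'; elim=> {y l} [|y z w l _ IH st we]; first exact: qh_chain0.
exact: qh_chainS IH st (le_trans we ee').
Qed.

Context (Ocon : connected Omega).

Lemma qh_chain_approx (e : R) (x y : Omega) : 0 < e ->
  exists2 l, l < qh_metric Omega x y + e & qh_chain e (\val x) (\val y) l.
Proof.
move=> e0; have e2 : 0 < e / 2 by lra.
have [l0 /(rectifiable_of_qh_chain (qh_valP x))[g0 [a0 [b0 [gr0 _]]]]] :=
  qh_chain_connected Ocon (qh_valP x) (qh_valP y).
have [|_ [g [a [b [gr ->]]]] gl] := @inf_adherent _ [set l | exists g a b,
    rectifiable_curve Omega (\val x) (\val y) g a b /\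
    l = line_integral (fun z => (boundary_dist Omega z)^-1) g a b] _ e2.
  split; last by exists 0; exact: qh_lengths_ge0.
  by exists (line_integral qh_density g0 a0 b0), g0, a0, b0.
have [S0 Hlip HO H0 HS] := arclength_param_unit_speed gr.
have [l le] := qh_chain_of_curve S0 Hlip HO e2.
rewrite H0 HS => xy.
exists l; last by apply: qh_chain_le xy; lra.
move: gl le; rewrite /line_integral /qh_metric; lra.
Qed.

(** * The quasihyperbolic metric *)

Local Notation k := (qh_metric Omega).

Lemma compact_closure_bounded (A : set 'rV[R]_n) :
  bounded_set A -> compact (closure A).
Proof.
move=> [M [Mreal MA]]; apply: bounded_closed_compact; last exact: closed_closure.
exists (M + 2); split=> [|b Mb x clx]; first exact: num_real.
have [y [/(MA (M + 1)) yM]] := clx _ (nbhsx_ballx x 1 ltr01).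
rewrite -ball_normE /= => xy.
have {}yM : `|y| <= M + 1 by apply: yM; rewrite ltrDl.
by have := ler_normD (x - y) y; rewrite subrK; lra.
Qed.

Lemma qh_metricxx (x : Omega) : k x x = 0.
Proof.
apply/eqP; rewrite eq_le; apply/andP; split.
  exact: (@qh_le_chain 0 0 x x (qh_chain0 _ _)).
apply/ler_addgt0Pr => e /(qh_chain_approx x x)[l le /qh_chain_ge0].
by move=> /le_trans; apply; exact: ltW.
Qed.

Lemma qh_metricC (x y : Omega) : k x y = k y x.
Proof.
suff h (a b : Omega) : k a b <= k b a by apply/eqP; rewrite eq_le !h.
apply/ler_addgt0Pr => e /(qh_chain_approx b a)[l le /qh_chainC/qh_le_chain].
by move=> /le_trans; apply; exact: ltW.
Qed.

Lemma qh_metric_triangle (x y z : Omega) : k x z <= k x y + k y z.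
Proof.
apply/ler_addgt0Pr => e e0; have e2 : 0 < e / 2 by lra.
have [l le xy] := qh_chain_approx x y e2.
have [l' l'e yz] := qh_chain_approx y z e2.
have := qh_le_chain (qh_chain_cat xy yz); lra.
Qed.

Lemma qh_metric_sep (x y : Omega) : k x y = 0 -> x = y.
Proof.
move=> xy; apply: val_inj; apply: euc_dist_eq0.
have x0 := boundary_dist_gt0 (qh_valP x).
apply/ler_addgt0Pr => e e0; rewrite add0r.
pose h := Num.min (1 / 2) (e / rho (\val x) / 2).
have h0 : 0 < h by rewrite lt_min !divr_gt0.
have [l] := qh_chain_approx x y h0.
rewrite xy add0r lt_min => /andP[l2 le].
move=> /(qh_chain_dist (qh_valP x)) /(_ (ltW l2)) /le_trans; apply.
by move: le; rewrite ltr_pdivlMr// ltr_pdivlMr// (mulrC 2) => /ltW.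
Qed.

Lemma qh_metric_near (x y : Omega) : E (\val x) (\val y) <= rho (\val x) / 4 ->
  k x y <= 2 * E (\val x) (\val y) / rho (\val x).
Proof.
move=> xy; have st := qh_step_near (qh_valP x) xy.
apply: (@qh_le_chain (2 * E (\val x) (\val y) / rho (\val x))).
rewrite -[X in qh_chain _ _ _ X]addr0.
exact: qh_chain_cons st (lexx _) (qh_chain0 _ _).
Qed.

Lemma qh_chain_curve e (x : Omega) y l : 0 <= e -> qh_chain e (\val x) y l ->
  exists c : R -> Omega, [/\ c 0 = x, forall t, l <= t -> \val (c t) = y &
    forall s t, 0 <= s -> s <= t -> k (c s) (c t) <= t - s + e].
Proof.
move=> e0; elim=> {y l} [|y z w l xy [c [c0 cl cd]] yz we].
  exists (fun=> x); split => // s t s0 st.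
  by rewrite qh_metricxx addr_ge0// subr_ge0.
have Oz : Omega z.
  exact: qh_step_inside yz (qh_chain_inside xy (qh_valP x)).
have w0 := qh_step_ge0 yz; have l0 := qh_chain_ge0 xy.
pose z' : Omega := exist (fun z => z \in Omega) z (mem_set Oz).
exists (fun t => if t < l + w then c t else z'); split => [|t|s t s0 st].
(* If [l + w = 0], the jump to [z] occurs at time 0, but a step of weight 0 does not move. *)
- case: ltP => // lw; apply: val_inj => /=.
  have {}lw : l = 0 /\ w = 0 by split; lra.
  rewrite -c0 cl ?lw.1//; apply/esym/euc_dist_eq0.
  by have [m [_ _ _]] := yz; rewrite lw.2 mul0r.
- by rewrite leNgt => /negbTE ->.
have yz' s' : l <= s' -> k (c s') z' <= w.
  move=> ls; apply: (@qh_le_chain e); rewrite cl//= -[X in qh_chain _ _ _ X]addr0.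
  exact: qh_chain_cons yz we (qh_chain0 _ _).
case: (ltP t) => tlw.
  by rewrite (le_lt_trans st tlw) cd.
case: ltP => slw; last by rewrite qh_metricxx addr_ge0// subr_ge0.
have [sl|/ltW ls] := leP s l.
  have := qh_metric_triangle (c s) (c l) z'.
  have := cd s l s0 sl; have := yz' l (lexx _); lra.
by have := yz' s ls; lra.
Qed.

(** The curve of a chain reaches [y] only at time [l], which exceeds [k x y] by less than [e / 2];
    forcing the value [y] already at [k x y] costs this excess on top of the step bound [e / 2]. *)
Lemma qh_approx_geodesic (x y : Omega) (e : R) : 0 < e ->
  exists c : R -> Omega, [/\ c 0 = x, c (k x y) = y &
    forall s t, 0 <= s -> s <= t -> t <= k x y -> k (c s) (c t) <= t - s + e].
Proof.
move=> e0; have e2 : 0 < e / 2 by lra.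
have [l le xy] := qh_chain_approx x y e2.
have Ll := qh_le_chain xy.
have [c [c0 cl cd]] := qh_chain_curve (ltW e2) xy.
exists (fun t => if t < k x y then c t else y); split.
- case: ltP => // L0; apply/esym/qh_metric_sep.
  apply/eqP; rewrite eq_le L0/=; have := qh_metric_triangle x y x.
  by rewrite (qh_metricC y) qh_metricxx; lra.
- by rewrite ltxx.
move=> s t s0 st tL; case: (ltP t) => tL'.
  by rewrite (le_lt_trans st tL'); have := cd s t s0 st; lra.
case: ltP => sL; last by rewrite qh_metricxx; lra.
have <- : c l = y by apply: val_inj; exact: cl.
have := cd s l s0; lra.
Qed.

(** Euclidean compactness of the closure gives a Euclidean limit [p]; the bound on [k] keeps [p] off
    the boundary; near a point of [Omega], [k] is controlled by the Euclidean distance. *)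
Lemma qh_bounded_ultralimit (W : set_system nat) (u : nat -> Omega) (x : Omega)
    (r : R) : bounded_set Omega -> UltraFilter W ->
  (\forall j \near W, k x (u j) <= r) -> exists p, ultralimit k W u p.
Proof.
move=> Obnd Wultra ur.
have cpt : compact (closure Omega).
  exact: compact_closure_bounded.
have Fcl : ((\val \o u) @ W) (closure Omega).
  by apply: (@filterE _ W) => j; apply: subset_closure; exact: qh_valP.
have [p [clp clup]] := cpt _ _ Fcl.
(* An ultrafilter converges to its cluster point: otherwise it would contain the complement of a
   ball around [p]. *)
have up (e : R) : 0 < e -> \forall j \near W, E p (\val (u j)) < e.
  move=> e0; have [//|nW] := in_ultra_setVsetC [set j | E p (\val (u j)) < e] Wultra.
  have [] := clup (~` [set z | E p z < e]) [set z | E p z < e].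
  - by [].
  - by apply/nbhs_euc_dist; exists e.
  - by move=> z [].
have x0 := boundary_dist_gt0 (qh_valP x).
(* Some chain from [x] to [u j] has weight below [r + 1], so [a] bounds the boundary distance of
   [u j] from below. *)
pose a := rho (\val x) / expR (r + 1).
have a0 : 0 < a by rewrite divr_gt0// expR_gt0.
have ua : \forall j \near W, a <= rho (\val (u j)).
  near=> j; have [l ll /(qh_chain_boundary_dist (qh_valP x))] :=
    qh_chain_approx x (u j) (@ltr01 R).
  move=> /le_trans h; rewrite ler_pdivrMr ?expR_gt0// mulrC; apply: h.
  rewrite ler_pM2r; last exact/boundary_dist_gt0/qh_valP.
  rewrite ler_expR; apply: ltW; apply: lt_le_trans ll _; rewrite lerD2r.
  by near: j.
have p0 : 0 < rho p.
  have a2 : 0 < a / 2 by lra.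
  near W => j.
  have : a <= rho (\val (u j)) by near: j.
  have : E p (\val (u j)) < a / 2 by near: j; exact: up.
  by have := boundary_dist_lipschitz (\val (u j)) p; rewrite euc_distC; lra.
have Op := boundary_dist_closure clp p0.
pose p' : Omega := exist (fun z => z \in Omega) p (mem_set Op).
exists p' => e e0; near=> j.
rewrite qh_metricC.
have up1 : E p (\val (u j)) <= rho p / 4.
  by apply: ltW; near: j; apply: up; lra.
apply: le_lt_trans (@qh_metric_near p' (u j) up1) _ => /=.
rewrite ltr_pdivrMr// mulrC -ltr_pdivlMr//.
by near: j; apply: up; rewrite divr_gt0// mulr_gt0.
Unshelve. all: by end_near. Qed.

End BoundaryDistance.

(** * The continuous extension of the identity *)

(** If [u] left an open neighborhood of [x] infinitely often, a subsequence would lie in the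
    complement, which is closed under [gromov_cvg], and would still converge to [x]. *)
Lemma gromov_cvg_nbhs {R : realType} {X : Type} {d : X -> X -> R} {o : X}
    (u : nat -> gromov_compactification d o) (x : gromov_compactification d o) :
  gromov_cvg u x -> u @ \oo --> x.
Proof.
move=> ux A; rewrite nbhsE => -[B [Bo Bx] BA].
apply: (filterS BA); apply: contrapT => nB.
have [|f fi fB] := @frequently_subseq (fun k => (~` B) (u k)).
  move=> N; apply: contrapT => nN; apply: nB; exists N => // k /= Nk.
  by apply: contrapT => Bk; apply: nN; exists k.
exact: (Bo _ _ fB (gromov_cvg_subseq fi ux)).
Qed.

Section ContinuousExtension.
Context {R : realType} {n : nat} (Omega : set 'rV[R]_n).
Context (Omega_domain : domain Omega) (Omega_proper : Omega `<` setT)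
  (Omega_bounded : bounded_set Omega)
  (Omega_hyperbolic : gromov_hyperbolic (qh_metric Omega)).
Context (o : Omega)
  (Phi : gromov_compactification (qh_metric Omega) o -> closure Omega).
Context (Phi_continuous : continuous Phi)
  (Phi_surjective : forall y : closure Omega, exists x, Phi x = y)
  (Phi_extends_id : forall x : Omega, \val (Phi (gromov_pt x)) = \val x).
Context (W : set_system nat).
Context (Wultra : UltraFilter W) (Wfree : \oo `<=` W).

Local Notation k := (qh_metric Omega).
Local Notation G := (gromov_compactification k o).

Let Oopen : open Omega. Proof. by case: Omega_domain. Qed.
Let Ocon : connected Omega. Proof. by case: Omega_domain. Qed.
Let Onontriv : Omega !=set0. Proof. by case: Omega_domain. Qed.

Let kxx := qh_metricxx Oopen Onontriv Omega_proper Ocon.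
Let kC := qh_metricC Oopen Onontriv Omega_proper Ocon.
Let ktri := qh_metric_triangle Oopen Onontriv Omega_proper Ocon.
Let ksep := qh_metric_sep Oopen Onontriv Omega_proper Ocon.

Let kbnd (u : nat -> Omega) (x : Omega) (r : R) :
  (\forall j \near W, k x (u j) <= r) -> exists p, ultralimit k W u p.
Proof. exact: qh_bounded_ultralimit. Qed.

Let kgeod (x y : Omega) : exists c : R -> Omega,
  [/\ geodesic k (k x y) c, c 0 = x & c (k x y) = y].
Proof.
apply: (geodesic_of_approx_geodesics kxx kC ktri ksep Wultra Wfree kbnd) => e.
exact: qh_approx_geodesic.
Qed.

Let kray_cvg := ray_cvg kxx kC ktri ksep Wultra Wfree kbnd kgeod Omega_hyperbolic o.

Lemma extension_cvg (u : nat -> G) (x : G) : gromov_cvg u x ->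
  (fun j => \val (Phi (u j))) @ \oo --> \val (Phi x).
Proof.
move=> /gromov_cvg_nbhs ux.
have Px : Phi (u j) @[j --> \oo] --> Phi x := cvg_comp _ _ ux (@Phi_continuous x).
exact: cvg_comp _ _ Px (@initial_continuous _ _ set_val (Phi x)).
Qed.

Lemma ray_extension_cvg (b : R -> Omega) (t : nat -> R) (xi : gromov_boundary k) :
  geodesic_ray k b -> \val xi b -> t @ \oo --> +oo ->
  (fun j => \val (b (t j))) @ \oo --> \val (Phi (gromov_infty xi)).
Proof.
move=> bg xib /cvgryPge tk; have := extension_cvg (kray_cvg bg xib tk).
by under eq_fun do rewrite Phi_extends_id.
Qed.

Lemma limit_set_ray (b : R -> Omega) (xi : gromov_boundary k) :
  geodesic_ray k b -> \val xi b ->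
  limit_set (pinfty_nbhs R) b = [set \val (Phi (gromov_infty xi))].
Proof.
move=> bg xib; apply/seteqP; split => [x [_ [t tk bx]]|_ ->].
  apply: cvg_unique bx (ray_extension_cvg bg xib tk); exact: norm_hausdorff.
split; first by have := valP (Phi (gromov_infty xi)); rewrite inE.
have nk : (fun j : nat => j%:R : R) @ \oo --> +oo.
  by apply/cvgryPge => M; exact: near_le_natr.
by exists (fun j => j%:R); [exact: nk|exact: ray_extension_cvg].
Qed.

Lemma limit_set_opp (b : R -> Omega) :
  limit_set (ninfty_nbhs R) b = limit_set (pinfty_nbhs R) (b \o -%R).
Proof.
apply/seteqP; split => x [clx [t tk bx]]; split => //; exists (\- t).
- exact/cvgNry.
- by under eq_fun do rewrite /= opprK.
- exact/cvgNrNy.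
- exact: bx.
Qed.

(** A ray towards [xi] goes to infinity in [k]; if it approached [p] in the Euclidean sense,
    [qh_metric_near] would keep it within 1 of [p]. *)
Lemma extension_infty (xi : gromov_boundary k) (p : Omega) :
  \val (Phi (gromov_infty xi)) <> \val p.
Proof.
move=> xip.
have [c [c0 cg xic]] := ray_from kxx kC ktri ksep Wultra Wfree kbnd kgeod
  Omega_hyperbolic o xi.
have nk : (fun j : nat => j%:R : R) @ \oo --> +oo.
  by apply/cvgryPge => M; exact: near_le_natr.
have := ray_extension_cvg cg xic nk; rewrite xip => /cvg_euc_dist cp.
have p0 := boundary_dist_gt0 Oopen Onontriv Omega_proper (qh_valP p).
near \oo => j.
have pj : euc_dist (\val p) (\val (c j%:R)) <= boundary_dist Omega (\val p) / 4.
  by apply: ltW; near: j; apply: cp; rewrite divr_gt0.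
have := qh_metric_near Oopen Onontriv Omega_proper pj.
have : 2 * euc_dist (\val p) (\val (c j%:R)) / boundary_dist Omega (\val p) <= 1.
  by rewrite ler_pdivrMr// mul1r; lra.
have : k o p + 2 <= j%:R by near: j; exact: near_le_natr.
have := ktri o p (c j%:R).
have -> : k o (c j%:R) = j%:R.
  by rewrite -c0 cg/= ?in_itv/= ?lexx ?ler0n// sub0r normrN ger0_norm.
lra.
Unshelve. all: by end_near. Qed.

Lemma geodesic_line_rays (g : R -> Omega) : geodesic_line k g ->
  geodesic_ray k g /\ geodesic_ray k (g \o -%R).
Proof.
move=> gl; split => s t _ _ /=; rewrite gl//.
by rewrite -opprD normrN.
Qed.

Lemma extension_injective : no_geodesic_loops Omega -> injective Phi.
Proof.
move=> noloop [p|xi] [q|eta] pq.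
- by congr gromov_pt; apply: val_inj; rewrite -!Phi_extends_id pq.
- case: (@extension_infty eta p); by rewrite -pq Phi_extends_id.
- case: (@extension_infty xi q); by rewrite pq Phi_extends_id.
congr gromov_infty; apply: contrapT => xieta.
have [g [gl xig etag]] := geodesic_line_between kxx kC ktri ksep Wultra Wfree
  kbnd kgeod Omega_hyperbolic o xieta.
have [gr gr'] := geodesic_line_rays gl.
apply: (noloop g); split => //.
by rewrite limit_set_opp (limit_set_ray gr etag) (limit_set_ray gr' xig) pq.
Qed.

(** A line has two different ends: [g t] and [g (- t)] are at distance [2 * t], so its two halves
    are not asymptotic. *)
Lemma injective_no_geodesic_loops : injective Phi -> no_geodesic_loops Omega.
Proof.
move=> Pinj g [gl]; have [gr gr'] := geodesic_line_rays gl.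
have [xi xig] := ray_end kxx gr; have [eta etag] := ray_end kxx gr'.
rewrite limit_set_opp (limit_set_ray gr xig) (limit_set_ray gr' etag).
move=> /seteqP[+ _]; move=> /(_ _ erefl) /= /val_inj/Pinj[xieta]; subst eta.
have [_ [M gM]] := (gromov_boundary_memP kC ktri _ xig).1 etag.
have [T T0 MT] : exists2 T : R, 0 <= T & M < T.
  exists (`|M| + 1); first by rewrite addr_ge0.
  by have := ler_norm M; lra.
by have := gM T T0; rewrite /= gl// opprK ger0_norm ?addr_ge0//; lra.
Qed.

(** The inverse [g] pulls closed sets back to closed sets: a point [y] in the closure of the
    preimage of [B] is the limit of a sequence [v] in it, a subsequence of [g \o v] converges to
    some [x] in [B] by sequential compactness, and applying [Phi] gives [y = Phi x]. *)
Lemma injective_homeomorphism : injective Phi -> homeomorphism Phi.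
Proof.
move=> Pinj; split => //.
have /choice[g Pg] := Phi_surjective.
exists g; split => //; last by move=> x; apply: Pinj; rewrite Pg.
apply/continuous_closedP => B Bcl y cly.
have /choice[v vP] (j : nat) : exists v : closure Omega,
    B (g v) /\ euc_dist (\val y) (\val v) < j.+1%:R^-1.
  have ny : nbhs y [set z : closure Omega | euc_dist (\val y) (\val z) < j.+1%:R^-1].
    apply: (@initial_continuous _ _ set_val y
      [set z | euc_dist (\val y) z < j.+1%:R^-1]).
    by apply/nbhs_euc_dist; exists j.+1%:R^-1.
  by have [v [Bv yv]] := cly _ ny; exists v.
have [f fi [x vx]] := gromov_seq_compact kxx kC ktri ksep Wultra Wfree kbnd kgeod
  Omega_hyperbolic (g \o v).
have Bgcl : gromov_closed B.
  have := closed_openC Bcl.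
  by rewrite /open/= /gromov_open setCK.
have Bx : B x by apply: (Bgcl _ _ _ vx) => j; exact: (vP _).1.
have gPx : g (Phi x) = x by apply: Pinj; rewrite Pg.
suff -> : y = Phi x by rewrite /= gPx.
apply: val_inj; have := extension_cvg vx; under eq_fun do rewrite /= Pg.
move=> vPx; apply: cvg_unique vPx; first exact: norm_hausdorff.
apply/cvg_euc_dist => e e0; near=> j.
apply: lt_le_trans (vP (f j)).2 _ => /=.
apply: (@le_trans _ _ j.+1%:R^-1).
  by rewrite lef_pV2 ?posrE// ler_nat ltnS; exact: leq_increasing.
by apply: ltW; near: j; exact: (near_infty_natSinv_lt (PosNum e0)).
Unshelve. all: by end_near. Qed.

End ContinuousExtension.

Unset Implicit Arguments.

Theorem theorem2p3 (R : realType) (n : nat) (Omega : set 'rV[R]_n)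
    (Omega_domain : domain Omega) (Omega_proper : Omega `<` setT)
    (Omega_bounded : bounded_set Omega)
    (Omega_hyperbolic : gromov_hyperbolic (qh_metric Omega))
    (Omega_visible : qh_visible Omega)
    (o : Omega)
    (Phi : gromov_compactification (qh_metric Omega) o -> closure Omega)
    (Phi_continuous : continuous Phi)
    (Phi_surjective : forall y : closure Omega, exists x, Phi x = y)
    (Phi_extends_id : forall x : Omega, \val (Phi (gromov_pt x)) = \val x) :
  homeomorphism Phi <-> no_geodesic_loops Omega.
Proof.
(* A single ultrafilter serves all the limits in both directions. *)
have [W [Wultra Wfree]] := ultraFilterLemma eventually_filter.
split=> [[_ [g [_ gK _]]]|noloop].
  exact: (injective_no_geodesic_loops Omega_domain Omega_proper Omega_bounded
    Omega_hyperbolic Phi_continuous Phi_extends_id Wultra Wfree (can_inj gK)).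
apply: (injective_homeomorphism Omega_domain Omega_proper Omega_bounded
  Omega_hyperbolic Phi_continuous Phi_surjective Wultra Wfree).
exact: (extension_injective Omega_domain Omega_proper Omega_bounded
  Omega_hyperbolic Phi_continuous Phi_extends_id Wultra Wfree noloop).
Qed.
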